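(* Let $\mathscr{A}$ be a $C^*$-algebra, let $\mathscr{X}$ be a Hilbert $\mathscr{A}$-module, and let $x,y_1,\dots,y_n\in\mathscr{X}$. Then $$\left(\sum_{i=1}^n|\langle y_i,x\rangle|^2\right)^2\le |x|^2\sum_{i=1}^n\|\langle y_i,x\rangle\|^2\left[\max_{1\le i\le n}\|y_i\|^2+\left(\sum_{1\le i\neq j\le n}\|\langle y_i,y_j\rangle\|^2\right)^{1/2}\right].$$
   Context: A Hilbert $\mathscr{A}$-module over a $C^*$-algebra $\mathscr{A}$ is a complex linear space $\mathscr{X}$ that is a right $\mathscr{A}$-module with compatible scalar multiplication ($\lambda(xa)=x(\lambda a)=(\lambda x)a$), equipped with an $\mathscr{A}$-valued inner product $\langle\cdot,\cdot\rangle:\mathscr{X}\times\mathscr{X}\to\mathscr{A}$ satisfying: $\langle x,x\rangle\ge 0$, with $\langle x,x\rangle=0$ iff $x=0$; $\langle x,\lambda y+z\rangle=\lambda\langle x,y\rangle+\langle x,z\rangle$; $\langle x,ya\rangle=\langle x,y\rangle a$; $\langle x,y\rangle^*=\langle y,x\rangle$; and complete for the norm $\|x\|=\|\langle x,x\rangle\|^{1/2}$. (The inner product is thus linear in the second variable and conjugate-linear in the first.) For $x\in\mathscr{X}$, $|x|=\langle x,x\rangle^{1/2}\in\mathscr{A}$; for $a\in\mathscr{A}$, $|a|=(a^*a)^{1/2}$. Inequalities are in the usual order on self-adjoint elements of $\mathscr{A}$: $a\le b$ iff $b-a$ is positive. The sum over $1\le i\neq j\le n$ runs over all ordered pairs $(i,j)$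 with $i\neq j$. *)

(* Defs.v *)
From HB Require Import structures.
From mathcomp Require Import all_boot all_order all_algebra.
From mathcomp Require Import complex.
From mathcomp Require Import all_classical all_reals all_analysis.

Set Implicit Arguments.
Unset Strict Implicit.
Unset Printing Implicit Defensive.

Import Order.TTheory GRing.Theory Num.Theory.
Import numFieldNormedType.Exports.

Local Open Scope classical_set_scope.
Local Open Scope ring_scope.

(* A C*-algebra need not have a unit, so it is not built on the ring hierarchy.
   The norm of a normedModType R[i] takes values in R[i] (in its nonnegative
   reals). *)
HB.mixin Record CompleteNormedModule_isCstarAlgebra (R : realType) A
    of CompleteNormedModule R[i] A := {
  cmul : A -> A -> A;
  star : A -> A;
  cmulA : forall a b c : A, cmul a (cmul b c) = cmul (cmul a b) c;
  cmulDl : forall a b c : A, cmul (a + b) c = cmul a c + cmul b c;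
  cmulDr : forall a b c : A, cmul a (b + c) = cmul a b + cmul a c;
  cmulZl : forall (l : R[i]) (a b : A), cmul (l *: a) b = l *: cmul a b;
  cmulZr : forall (l : R[i]) (a b : A), cmul a (l *: b) = l *: cmul a b;
  norm_cmul : forall a b : A, `|cmul a b| <= `|a| * `|b|;
  starD : forall a b : A, star (a + b) = star a + star b;
  starZ : forall (l : R[i]) (a : A), star (l *: a) = Num.conj l *: star a;
  starM : forall a b : A, star (cmul a b) = cmul (star b) (star a);
  starK : forall a : A, star (star a) = a;
  norm_star_cmul : forall a : A, `|cmul (star a) a| = `|a| ^+ 2
}.

#[short(type="cstarAlgType")]
HB.structure Definition CstarAlgebra (R : realType) :=
  {A of CompleteNormedModule R[i] A & CompleteNormedModule_isCstarAlgebra R A}.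

Section CstarOrder.
Variables (R : realType) (A : cstarAlgType R).
Implicit Types a b : A.

Definition csquare a : A := cmul a a.

(* Product of the unitization A (+) C, where the pair (a, l) stands for
   a + l 1 and the unit is (0, 1). *)
Definition unitization_mul (p q : A * R[i]) : A * R[i] :=
  (cmul p.1 q.1 + p.2 *: q.1 + q.2 *: p.1, p.2 * q.2).

(* Spectrum in the unitization. When A already has a unit this adds at most
   the point 0 to the spectrum in A, which does not affect positivity. *)
Definition cspectrum a : set R[i] :=
  [set l | ~ exists q : A * R[i],
      unitization_mul (a, - l) q = (0, 1) /\
      unitization_mul q (a, - l) = (0, 1)].

(* In R[i], 0 <= l says that l is real and nonnegative. *)
Definition cpositive a : Prop :=
  star a = a /\ (forall l : R[i], cspectrum a l -> 0 <= l).

Definition cle a b : Prop := cpositive (b - a).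

(* The positive square root; it exists and is unique when a is positive, and
   the default value 0 of xget plays no role in that case. *)
Definition csqrt a : A := xget 0 [set b : A | cpositive b /\ csquare b = a].

Definition cabs a : A := csqrt (cmul (star a) a).

End CstarOrder.

HB.mixin Record CompleteNormedModule_isHilbertModule (R : realType)
    (A : cstarAlgType R) X of CompleteNormedModule R[i] X := {
  hact : X -> A -> X;
  hinner : X -> X -> A;
  hactDl : forall (x y : X) (a : A), hact (x + y) a = hact x a + hact y a;
  hactDr : forall (x : X) (a b : A), hact x (a + b) = hact x a + hact x b;
  hactA : forall (x : X) (a b : A), hact x (cmul a b) = hact (hact x a) b;
  hactZl : forall (l : R[i]) (x : X) (a : A), hact (l *: x) a = l *: hact x a;
  hactZr : forall (l : R[i]) (x : X) (a : A), hact x (l *: a) = l *: hact x a;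
  hinner_ge0 : forall x : X, cpositive (hinner x x);
  hinner_eq0 : forall x : X, hinner x x = 0 <-> x = 0;
  hinner_linearr : forall (l : R[i]) (x y z : X),
    hinner x (l *: y + z) = l *: hinner x y + hinner x z;
  hinner_actr : forall (x y : X) (a : A),
    hinner x (hact y a) = cmul (hinner x y) a;
  star_hinner : forall x y : X, star (hinner x y) = hinner y x;
  hnormE : forall x : X, `|x| = sqrtC `|hinner x x|
}.

#[short(type="hilbertModType")]
HB.structure Definition HilbertModule (R : realType) (A : cstarAlgType R) :=
  {X of CompleteNormedModule R[i] X &
        CompleteNormedModule_isHilbertModule R A X}.

Definition habs (R : realType) (A : cstarAlgType R) (X : hilbertModType A)
  (x : X) : A := csqrt (hinner x x).

(* Main.v *)
Require Import Defs.
From HB Require Import structures.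
From mathcomp Require Import all_boot all_order all_algebra.
From mathcomp Require Import complex.
From mathcomp Require Import all_classical all_reals all_analysis.
From mathcomp Require Import ring lra.

Set Implicit Arguments.
Unset Strict Implicit.
Unset Printing Implicit Defensive.

Import Order.TTheory GRing.Theory Num.Theory.
Import numFieldNormedType.Exports.
Local Open Scope ring_scope.
Local Open Scope complex_scope.

(** Put [a i = <y i, x>] and [z = \sum_i y i . a i]. The sum on the left is
    [S = \sum_i (a i)^* (a i) = <x, z>], which is selfadjoint, so its square is
    [<x, z> <z, x>] and the Cauchy-Schwarz inequality of Hilbert modules
    ([cauchy_schwarz_module]) gives [S ^ 2 <= |<z, z>| <x, x>]. The norm of
    [<z, z> = \sum_(i, j) (a i)^* <y i, y j> (a j)] is at most
    [\sum_(i, j) |a i| |<y i, y j>| |a j|]; bounding the diagonal by the maximum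
    and the rest by the scalar Cauchy-Schwarz inequality over the pairs [i != j]
    gives the stated coefficient ([quadratic_form_le]).

    The weight of the proof lies in the facts about positive elements which this
    argument takes for granted, positivity being defined by the spectrum: sums of
    positive elements are positive, positive elements have positive square roots,
    and [a^* a] is positive. They are established for unital C*-algebras and
    brought back to [A] through its unitization.

    The bridge between spectrum and norm is that a selfadjoint element whose
    spectrum lies in the disc of radius [t] has norm at most [t]
    ([selfadjoint_norm_le]). It rests on an elementary argument of Rickart: if
    [1 - l x] is invertible throughout the unit disc, then the powers
    [x ^ (2 ^ k)] are bounded ([bounded_powers]), while the C*-identity makes
    their norms equal to the powers of the norm of [x]. It follows that [a] is
    positive exactly when it is selfadjoint and [|t - a| <= t] for some
    [t >= |a|] ([upositive_of_norm], [norm_upositive]). In this form positivity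
    is visibly additive, and square roots come from the iteration
    [y := (x + y ^ 2) / 2], which converges to [1 - sqrt (1 - x)]
    ([upositive_sqrt]).

    For [h = c^* c], let [k] be the square root of [h ^ 2] and [w = k - h]. Then
    [(c w)^* (c w) = w h w] is minus the square of a selfadjoint element, and an
    element [d] with [- d^* d] positive must vanish ([star_mul_nonpositive]); this
    forces [w = 0], so [h = k] is positive ([upositive_star_mul]). *)

(** * Norms with real values *)

(** The norms at hand take their values in the partially ordered field [R[i]];
    all estimates are carried out on their real parts instead, where the order is
    total. *)
Definition rnorm (R : realType) (V : normedZmodType R[i]) (v : V) : R :=
  complex.Re `|v|.

Section RealNorm.
Variable R : realType.

Lemma rnormE (V : normedZmodType R[i]) (v : V) : `|v| = (rnorm v)%:C.
Proof. by rewrite /rnorm RRe_real // normr_real. Qed.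

Lemma rnorm_ge0 (V : normedZmodType R[i]) (v : V) : 0 <= rnorm v.
Proof. by rewrite -ler0c -rnormE. Qed.

Lemma rnorm0 (V : normedZmodType R[i]) : rnorm (0 : V) = 0.
Proof. by rewrite /rnorm normr0. Qed.

Lemma rnorm0_eq0 (V : normedZmodType R[i]) (v : V) : rnorm v = 0 -> v = 0.
Proof. by move=> v0; apply: normr0_eq0; rewrite rnormE v0. Qed.

Lemma rnormD (V : normedZmodType R[i]) (u v : V) :
  rnorm (u + v) <= rnorm u + rnorm v.
Proof. by rewrite -lecR rmorphD /= -!rnormE ler_normD. Qed.

Lemma rnormN (V : normedZmodType R[i]) (v : V) : rnorm (- v) = rnorm v.
Proof. by rewrite /rnorm normrN. Qed.

Lemma rnormM (k l : R[i]) : rnorm (k * l) = rnorm k * rnorm l.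
Proof. by apply: complexI; rewrite rmorphM /= -!rnormE normrM. Qed.

Lemma rnormZ (V : normedModType R[i]) (l : R[i]) (v : V) :
  rnorm (l *: v) = rnorm l * rnorm v.
Proof. by apply: complexI; rewrite rmorphM /= -!rnormE normrZ. Qed.

Lemma rnorm1 : rnorm (1 : R[i]) = 1.
Proof. by rewrite /rnorm normr1. Qed.

Lemma rnormV (l : R[i]) : rnorm l^-1 = (rnorm l)^-1.
Proof. by apply: complexI; rewrite fmorphV /= -!rnormE normfV. Qed.

Lemma rnormX (l : R[i]) n : rnorm (l ^+ n) = rnorm l ^+ n.
Proof. by apply: complexI; rewrite rmorphXn /= -!rnormE normrX. Qed.

Lemma rnormC (r : R) : rnorm r%:C = `|r|.
Proof. by rewrite /rnorm normc_def /= expr0n addr0 sqrtr_sqr. Qed.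

Lemma rnorm_conj (l : R[i]) : rnorm (Num.conj l) = rnorm l.
Proof. by rewrite /rnorm norm_conjC. Qed.

Lemma rnorm_sqr (l : R[i]) : rnorm l ^+ 2 = complex.Re l ^+ 2 + complex.Im l ^+ 2.
Proof.
by rewrite /rnorm normc_def /= sqr_sqrtr ?addr_ge0 ?sqr_ge0.
Qed.

Lemma conjC_real (r : R) : Num.conj r%:C = r%:C.
Proof. by rewrite conj_Creal // complex_real. Qed.

Lemma rnorm_le_coord (z : R[i]) : rnorm z <= `|complex.Re z| + `|complex.Im z|.
Proof.
rewrite -(ler_pXn2r (n := 2)) ?nnegrE ?addr_ge0 ?rnorm_ge0 // rnorm_sqr.
rewrite sqrrD !real_normK ?num_real // -addrA addrCA -subr_ge0.
have := mulr_ge0 (normr_ge0 (complex.Re z)) (normr_ge0 (complex.Im z)); lra.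
Qed.

Lemma coord_le_rnorm (z : R[i]) :
  `|complex.Re z| <= rnorm z /\ `|complex.Im z| <= rnorm z.
Proof.
split; rewrite -(ler_pXn2r (n := 2)) ?nnegrE ?rnorm_ge0 //
  rnorm_sqr real_normK ?num_real //.
  by rewrite lerDl sqr_ge0.
by rewrite lerDr sqr_ge0.
Qed.

End RealNorm.

(** * Unital C*-algebras and limits in them *)

HB.mixin Record Algebra_isUnitalCstar (R : realType) B
    of GRing.Algebra R[i] B := {
  ustar : B -> B;
  unorm : B -> R;
  ustarD : forall a b : B, ustar (a + b) = ustar a + ustar b;
  ustarZ : forall (l : R[i]) (a : B), ustar (l *: a) = Num.conj l *: ustar a;
  ustarM : forall a b : B, ustar (a * b) = ustar b * ustar a;
  ustarK : forall a : B, ustar (ustar a) = a;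
  unormD : forall a b : B, unorm (a + b) <= unorm a + unorm b;
  unormZ : forall (l : R[i]) (a : B), unorm (l *: a) = rnorm l * unorm a;
  unormM : forall a b : B, unorm (a * b) <= unorm a * unorm b;
  unorm0_eq0 : forall a : B, unorm a = 0 -> a = 0;
  unorm_star_mul : forall a : B, unorm (ustar a * a) = unorm a ^+ 2;
  unorm_complete : forall u : nat -> B,
    (forall e : R, 0 < e ->
       exists n0, forall m n, (n0 <= m)%N -> (n0 <= n)%N -> unorm (u m - u n) < e) ->
    exists l : B, forall e : R, 0 < e ->
       exists n0, forall n, (n0 <= n)%N -> unorm (u n - l) < e
}.

#[short(type="unitalCstarType")]
HB.structure Definition UnitalCstar (R : realType) :=
  {B of GRing.Algebra R[i] B & Algebra_isUnitalCstar R B}.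

Section UnitalTheory.
Variables (R : realType) (B : unitalCstarType R).
Local Notation N := (@unorm R B).
Local Notation st := (@ustar R B).
Implicit Types a b c x : B.

Lemma unorm0 : N 0 = 0.
Proof. by rewrite -(scale0r 0) unormZ rnorm0 mul0r. Qed.

Lemma unormN a : N (- a) = N a.
Proof. by rewrite -scaleN1r unormZ rnormN rnorm1 mul1r. Qed.

Lemma unormB a b : N (a - b) <= N a + N b.
Proof. by rewrite -(unormN b) unormD. Qed.

Lemma unorm_distC a b : N (a - b) = N (b - a).
Proof. by rewrite -unormN opprB. Qed.

Lemma unorm_ge0 a : 0 <= N a.
Proof. by have := unormB a a; rewrite subrr unorm0; lra. Qed.

Lemma ustar1 : st 1 = 1.
Proof. by rewrite -[RHS]ustarK -[X in _ = st X]mul1r ustarM ustarK mul1r. Qed.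

Lemma unorm1 : N 1 = 1.
Proof.
have /eqP : N 1 * (N 1 - 1) = 0.
  by rewrite mulrBr mulr1 -expr2 -unorm_star_mul ustar1 mulr1 subrr.
rewrite mulf_eq0 subr_eq0 => /orP[/eqP N10|/eqP //].
by have /eqP := unorm0_eq0 _ N10; rewrite oner_eq0.
Qed.

Lemma ustar0 : st 0 = 0.
Proof. by rewrite -[X in st X](scale0r 0) ustarZ conjC0 scale0r. Qed.

Lemma ustarN a : st (- a) = - st a.
Proof. by rewrite -scaleN1r ustarZ rmorphN1 scaleN1r. Qed.

Lemma ustarB a b : st (a - b) = st a - st b.
Proof. by rewrite ustarD ustarN. Qed.

Lemma ustarX a n : st (a ^+ n) = st a ^+ n.
Proof. by elim: n => [|n IH]; rewrite ?expr0 ?ustar1 // exprS ustarM IH -exprSr. Qed.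

Lemma ustar_real (r : R) a : st (r%:C *: a) = r%:C *: st a.
Proof. by rewrite ustarZ conjC_real. Qed.

Lemma unorm_star a : N (st a) = N a.
Proof.
have le b : N b <= N (st b).
  have := unormM (st b) b; rewrite unorm_star_mul expr2.
  have := unorm_ge0 b; rewrite le_eqVlt => /predU1P[<- _|b0]; last by rewrite ler_pM2r.
  exact: unorm_ge0.
by apply/eqP; rewrite eq_le le -{2}[a]ustarK le.
Qed.

Lemma unormX a n : N (a ^+ n) <= N a ^+ n.
Proof.
elim: n => [|n IH]; first by rewrite !expr0 unorm1.
by rewrite !exprS (le_trans (unormM _ _)) // ler_wpM2l // unorm_ge0.
Qed.

Lemma unormC (r : R) a : N (r%:C *: a) = `|r| * N a.
Proof. by rewrite unormZ rnormC. Qed.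

Lemma unorm_scalar (l : R[i]) : N l%:A = rnorm l.
Proof. by rewrite unormZ unorm1 mulr1. Qed.

Definition uconv (u : nat -> B) (l : B) : Prop :=
  ((fun n => N (u n - l)) @ \oo --> (0 : R))%classic.

Lemma uconvP u l : uconv u l <-> forall e : R, 0 < e ->
  exists n0, forall n, (n0 <= n)%N -> N (u n - l) < e.
Proof.
split=> [/cvgrPdist_lt ul e /ul[n0 _ n0P]|ul].
  exists n0 => n /n0P /=; rewrite sub0r normrN ger0_norm //; exact: unorm_ge0.
apply/cvgrPdist_lt => e /ul[n0 n0P]; exists n0 => // n /= /n0P.
by rewrite sub0r normrN ger0_norm //; exact: unorm_ge0.
Qed.

Lemma uconv_squeeze u l (r : nat -> R) : (forall n, N (u n - l) <= r n) ->
  (r @ \oo --> (0 : R))%classic -> uconv u l.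
Proof.
move=> ur r0; apply: (@squeeze_cvgr _ _ _ _ (fun=> 0) r) => //; last exact: cvg_cst.
by apply: nearW => n; rewrite unorm_ge0 ur.
Qed.

Lemma uconv_cst l : uconv (fun=> l) l.
Proof. by rewrite /uconv subrr unorm0; exact: cvg_cst. Qed.

Lemma uconv_shift u l : uconv u l -> uconv (fun n => u n.+1) l.
Proof. by rewrite /uconv => ul; rewrite (cvg_shiftS (fun n => N (u n - l))). Qed.

Lemma uconvD u v l m : uconv u l -> uconv v m -> uconv (fun n => u n + v n) (l + m).
Proof.
move=> ul vm; apply: (@uconv_squeeze _ _ (fun n => N (u n - l) + N (v n - m))).
  by move=> n; rewrite opprD addrACA unormD.
by have := cvgD ul vm; rewrite addr0; exact.
Qed.

Lemma uconvZ (k : R[i]) u l : uconv u l -> uconv (fun n => k *: u n) (k *: l).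
Proof.
move=> ul; apply: (@uconv_squeeze _ _ (fun n => rnorm k * N (u n - l))).
  by move=> n; rewrite -scalerBr unormZ.
by have := cvgM (cvg_cst (rnorm k)) ul; rewrite mulr0; exact.
Qed.

Lemma uconvM u v l m : uconv u l -> uconv v m -> uconv (fun n => u n * v n) (l * m).
Proof.
move=> ul vm.
apply: (@uconv_squeeze _ _
  (fun n => N (u n - l) * N (v n - m) + N l * N (v n - m) + N (u n - l) * N m)).
  move=> n; have -> : u n * v n - l * m
    = (u n - l) * (v n - m) + l * (v n - m) + (u n - l) * m.
    by rewrite -mulrDl subrK mulrBr mulrBl addrA subrK.
  by do 2!(apply: le_trans (unormD _ _) _; apply: lerD; last exact: unormM);
    exact: unormM.
have -> : (0 : R) = 0 * 0 + N l * 0 + 0 * N m by rewrite !mul0r mulr0 !addr0.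
by do 2?apply: cvgD; apply: cvgM => //; exact: cvg_cst.
Qed.

Lemma uconv_star u l : uconv u l -> uconv (fun n => st (u n)) (st l).
Proof.
move=> ul; apply: (@uconv_squeeze _ _ (fun n => N (u n - l))) => // n.
by rewrite -ustarB unorm_star.
Qed.

Lemma uconv_unique u l m : uconv u l -> uconv u m -> l = m.
Proof.
move=> ul um; apply/eqP; rewrite -subr_eq0; apply/eqP/unorm0_eq0/eqP.
rewrite eq_le unorm_ge0 andbT.
have lim : ((fun n => N (u n - l) + N (u n - m)) @ \oo --> (0 + 0 : R))%classic.
  exact: cvgD.
rewrite addr0 in lim; apply: (cvgr_to_ge lim).
apply: nearW => n /=; rewrite (unorm_distC (u n)) (le_trans _ (unormD _ _)) //.
by rewrite addrA subrK.
Qed.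

Lemma uconv_norm_le u l (M : R) : (forall n, N (u n) <= M) -> uconv u l -> N l <= M.
Proof.
move=> uM /uconvP ul; apply/ler_addgt0Pr => e /ul[n0 /(_ _ (leqnn _)) n0P].
rewrite -(subrK (u n0) l) addrC (le_trans (unormD _ _)) // lerD //.
by rewrite unorm_distC ltW.
Qed.

(** The limits of this theory are all obtained by domination by a bounded
    monotone real sequence: the geometric one for the Neumann series, and for the
    square root the same iteration run on numbers. *)
Lemma dominated_conv (u : nat -> B) (r : nat -> R) (M : R) :
  (forall n, N (u n.+1 - u n) <= r n.+1 - r n) -> (forall n, r n <= M) ->
  exists l, uconv u l.
Proof.
move=> ur rM.
have udist m k : N (u (m + k)%N - u m) <= r (m + k)%N - r m.
  elim: k => [|k IH]; first by rewrite addn0 !subrr unorm0.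
  rewrite addnS -(subrK (u (m + k)%N) (u _.+1)) -addrA.
  by rewrite (le_trans (unormD _ _)) // (le_trans (lerD (ur _) IH)) // addrA subrK.
have rmono m n : (m <= n)%N -> r m <= r n.
  move=> /subnKC <-; rewrite -subr_ge0; apply: le_trans (udist _ _).
  exact: unorm_ge0.
suff cau : forall e : R, 0 < e -> exists n0, forall m n, (n0 <= m)%N ->
    (n0 <= n)%N -> N (u m - u n) < e.
  by have [l /uconvP] := unorm_complete _ cau; exists l.
move=> e e0.
have supr : has_sup [set r n | n in [set: nat]]%classic.
  by split; [exists (r 0%N), 0%N|exists M => _ [n _ <-]; apply: rM].
have e20 : 0 < e / 2 by rewrite divr_gt0.
have [_ [n0 _ <-] rn0] := sup_adherent e20 supr.
have rsup n : r n <= sup [set r n | n in [set: nat]]%classic.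
  by apply: sup_upper_bound => //; exists n.
have ud n : (n0 <= n)%N -> N (u n - u n0) < e / 2.
  move=> /subnKC <-; apply: (le_lt_trans (udist _ _)).
  by rewrite ltrBlDr (le_lt_trans (rsup _)) // addrC -ltrBlDr.
exists n0 => m n n0m n0n; rewrite -(subrK (u n0) (u m)) -addrA.
apply: (le_lt_trans (unormD _ _)); rewrite (unorm_distC (u n0)).
by rewrite [e]splitr ltrD ?ud.
Qed.

End UnitalTheory.

(** * Invertible elements *)

Section Inverses.
Variables (R : realType) (B : unitalCstarType R).
Local Notation N := (@unorm R B).
Implicit Types a b c x : B.

Definition is_inverse a b : Prop := a * b = 1 /\ b * a = 1.
Definition invertible a : Prop := exists b, is_inverse a b.

Lemma invertibleM a b : invertible a -> invertible b -> invertible (a * b).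
Proof.
move=> [a' [aa' a'a]] [b' [bb' b'b]]; exists (b' * a'); split.
  by rewrite mulrA -(mulrA a) bb' mulr1.
by rewrite mulrA -(mulrA b') a'a mulr1.
Qed.

Lemma invertibleZ (l : R[i]) a : l != 0 -> invertible a -> invertible (l *: a).
Proof.
move=> l0 [b [ab ba]]; exists (l^-1 *: b).
by split; rewrite -scalerAl -scalerAr scalerA ?mulfV ?mulVf // ?ab ?ba scale1r.
Qed.

Lemma invertibleN a : invertible a -> invertible (- a).
Proof. by rewrite -scaleN1r; apply: invertibleZ; rewrite oppr_eq0 oner_eq0. Qed.

Lemma neumann a : N a < 1 -> invertible (1 - a).
Proof.
move=> a1; have a0 := unorm_ge0 a.
pose u n := \sum_(i < n) a ^+ i; pose r n := \sum_(i < n) N a ^+ i.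
have uE n : (1 - a) * u n = 1 - a ^+ n.
  by rewrite -[RHS]opprB subrX1 -mulNr opprB.
have uE' n : u n * (1 - a) = 1 - a ^+ n.
  rewrite -uE /u mulr_suml mulr_sumr; apply: eq_bigr => i _.
  by rewrite mulrBr mulrBl mulr1 mul1r -exprS -exprSr.
have rE n : (1 - N a) * r n = 1 - N a ^+ n.
  by rewrite -[RHS]opprB subrX1 -mulNr opprB.
have [||l ul] := @dominated_conv R B u r (1 - N a)^-1.
- have incr (V : zmodType) (p q : V) : p + q - p = q by rewrite addrAC subrr add0r.
  by move=> n; rewrite /u /r !big_ord_recr /= !incr unormX.
- move=> n; rewrite -[_^-1]mulr1 ler_pdivlMl ?subr_gt0 // rE.
  by rewrite gerBl exprn_ge0.
have pow1 : uconv (fun n => 1 - a ^+ n) 1.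
  apply: (@uconv_squeeze _ _ _ _ (fun n => N a ^+ n)).
    by move=> n; rewrite addrAC subrr add0r unormN unormX.
  by apply: cvg_expr; rewrite ger0_norm.
exists l; split.
- apply: uconv_unique pow1; under eq_fun do rewrite -uE.
  by apply: uconvM => //; exact: uconv_cst.
- apply: uconv_unique pow1; under eq_fun do rewrite -uE'.
  by apply: uconvM => //; exact: uconv_cst.
Qed.

(** This confines the spectrum of [a] to the disc of radius [N a]. *)
Lemma neumann_scalar a (l : R[i]) : N a < rnorm l -> invertible (l%:A - a).
Proof.
move=> al; have l0 : l != 0.
  by apply: contraTneq al => ->; rewrite rnorm0 -leNgt unorm_ge0.
have -> : l%:A - a = l *: (1 - l^-1 *: a).
  by rewrite scalerBr scalerA mulfV // scale1r.
apply: invertibleZ => //; apply: neumann; rewrite unormZ rnormV.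
by rewrite ltr_pdivrMl ?mulr1 // (le_lt_trans (unorm_ge0 a)).
Qed.

(** Stability of inverses with a quantitative bound, so that the resolvent is
    locally bounded. *)
Lemma inverse_perturb a b c (M : R) : is_inverse a b -> N b <= M ->
  N c * M <= 2^-1 -> exists2 d, is_inverse (a - c) d & N d <= 2 * M.
Proof.
move=> [ab ba] bM cM.
have bc : N (b * c) <= 2^-1.
  rewrite (le_trans (unormM _ _)) // (le_trans _ cM) // mulrC.
  by rewrite ler_wpM2l // unorm_ge0.
have [|e [ce ec]] := @neumann (b * c); first by apply: le_lt_trans bc _; lra.
have e2 : N e <= 2.
  have : N e <= 1 + N (b * c) * N e.
    rewrite -[e in leLHS](subrK (b * c * e)) -[X in X - _]mul1r -mulrBl ce.
    by rewrite (le_trans (unormD _ _)) // unorm1 lerD2l unormM.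
  have := unorm_ge0 e; nra.
exists (e * b); first split.
- have -> : a - c = a * (1 - b * c) by rewrite mulrBr mulr1 mulrA ab mul1r.
  by rewrite mulrA -(mulrA a) ce mulr1.
- by rewrite mulrBr -!mulrA ba -mulrBr.
rewrite (le_trans (unormM _ _)) // ler_pM // unorm_ge0 //.
Qed.

End Inverses.

(** * Boundedness of powers *)

Section SpectralRadius.
Variables (R : realType) (B : unitalCstarType R).
Local Notation N := (@unorm R B).
Implicit Types a b c x : B.

(** Local bounds on the resolvent become a uniform one by compactness. The disc is
    seen inside a square of real coordinates, a product of segments; the property
    propagated by compactness is void off the disc, hence the case distinction
    on the norm of the point. *)
Lemma resolvent_bounded x :
  (forall l : R[i], rnorm l <= 1 -> invertible (1 - l *: x)) ->
  exists M : R, forall l : R[i], rnorm l <= 1 ->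
    exists2 b, is_inverse (1 - l *: x) b & N b <= M.
Proof.
move=> inv_x.
pose P (M : R) (z : R * R) := rnorm (z.1 +i* z.2) <= 1 ->
  exists2 b, is_inverse (1 - (z.1 +i* z.2) *: x) b & N b <= M.
pose K : set (R * R) := (`[(-1)%R, 1%R] `*` `[(-1)%R, 1%R])%classic.
have Kc : compact K by apply: compact_setX; exact: segment_compact.
have near_disc (z z' : R * R) d : ball z d z' ->
    rnorm ((z'.1 +i* z'.2) - (z.1 +i* z.2)) <= 2 * d.
  case=> /= b1 b2; rewrite (le_trans (rnorm_le_coord _)) //=.
  move: b1 b2; rewrite /ball /= => b1 b2.
  by rewrite mulr_natl mulr2n distrC lerD // ?(ltW b1) // distrC ltW.
have [M [_ MP]] : (\forall M \near +oo%R, K `<=` P M)%classic.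
  move: Kc => /compact_near_coveringP; apply => z _.
  have [z1|z1] := lerP (rnorm (z.1 +i* z.2)) 1; last first.
    pose d := (rnorm (z.1 +i* z.2) - 1) / 4.
    have d0 : 0 < d by rewrite divr_gt0 // subr_gt0.
    exists (ball z d, setT); first by split; [exact: nbhsx_ballx|exact: filterT].
    move=> [z' M] /= [/near_disc zz' _]; rewrite /P leNgt => /negP[].
    have tri (w w' : R[i]) : rnorm w <= rnorm w' + rnorm (w' - w).
      by rewrite -(rnormN (w' - w)) (le_trans _ (rnormD _ _)) // opprB addrC subrK.
    have := tri (z.1 +i* z.2) (z'.1 +i* z'.2) => {}tri.
    by rewrite /d in zz' d0; lra.
  have [b bP] := inv_x _ z1.
  have b0 := unorm_ge0 b; have x0 := unorm_ge0 x.
  (* Moving the parameter by at most [2 d] perturbs [1 - l x] by a quantity whose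
     product with [N b] is at most [1/2]. *)
  pose d := (4 * (N x + 1) * (N b + 1))^-1.
  have d0 : 0 < d by rewrite invr_gt0 !mulr_gt0 ?ltr_wpDl.
  exists (ball z d, [set M | 2 * N b <= M]%classic).
    by split; [exact: nbhsx_ballx|apply: nbhs_pinfty_ge; exact: num_real].
  move=> [z' M] /= [/near_disc zz' bM] _.
  have [|c cP cb] := @inverse_perturb R B _ _
    (((z'.1 +i* z'.2) - (z.1 +i* z.2)) *: x) _ bP (lexx _).
    rewrite unormZ; apply: (@le_trans _ _ (2 * d * N x * N b)).
      by rewrite !ler_wpM2r.
    rewrite /d; have -> : 2 / (4 * (N x + 1) * (N b + 1)) * N x * N b =
      2^-1 * ((N x / (N x + 1)) * (N b / (N b + 1))).
      by field; rewrite !gt_eqF // ltr_wpDl.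
    rewrite ger_pMr // mulr_ile1 ?divr_ge0 ?addr_ge0 // ler_pdivrMr ?ltr_wpDl //.
      by rewrite mul1r lerDl.
    by rewrite mul1r lerDl.
  exists c; last exact: le_trans bM.
  by move: cP; rewrite scalerBl opprB addrA subrK.
exists (M + 1) => l l1; have /MP : M < M + 1 by rewrite ltrDl.
have [re im] := coord_le_rnorm l.
have Kl : K (complex.Re l, complex.Im l).
  by split; rewrite /= in_itv /= -ler_norml (le_trans _ l1).
move=> /(_ _ Kl); rewrite /P /=.
have -> : complex.Re l +i* complex.Im l = l by case: (l).
exact.
Qed.


(** Partial fractions: [2 / (1 - a ^ 2) = 1 / (1 - a) + 1 / (1 + a)]. *)
Lemma inverse_sqr_avg a b c : is_inverse (1 - a) b -> is_inverse (1 + a) c ->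
  is_inverse (1 - a ^+ 2) (2^-1 *: (b + c)).
Proof.
move=> [ab ba] [ac ca].
have fac : 1 - a ^+ 2 = (1 - a) * (1 + a).
  by rewrite mulrDr mulr1 mulrBl mul1r addrA subrK expr2.
have fac' : 1 - a ^+ 2 = (1 + a) * (1 - a).
  by rewrite mulrBr mulr1 mulrDl mul1r opprD addrA addrK expr2.
have half : (2^-1 : R[i]) *: (1 + a + (1 - a)) = 1.
  by rewrite addrACA subrr addr0 scalerDr -scalerDl -[2^-1]mul1r -splitr scale1r.
split.
  rewrite -scalerAr mulrDr {1}fac' fac -!mulrA ab ac !mulr1; exact: half.
rewrite -scalerAl mulrDl {1}fac fac' !mulrA ba ca !mul1r; exact: half.
Qed.

(** The resolvent identity. *)
Lemma inverse_distance x (l m : R[i]) b c (M : R) :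
  is_inverse (1 - l *: x) b -> is_inverse (1 - m *: x) c ->
  N b <= M -> N c <= M -> N (b - c) <= M ^+ 2 * N x * rnorm (l - m).
Proof.
move=> [_ bl] [mc _] bM cM.
have -> : b - c = (l - m) *: (b * x * c).
  transitivity (b * ((1 - m *: x) - (1 - l *: x)) * c).
    by rewrite mulrBr mulrBl -mulrA mc mulr1 bl mul1r.
  have -> : (1 - m *: x) - (1 - l *: x) = (l - m) *: x.
    by rewrite opprB addrC addrA subrK scalerBl.
  by rewrite -scalerAr -scalerAl.
rewrite unormZ mulrC ler_wpM2r ?rnorm_ge0 //.
rewrite (le_trans (unormM _ _)) //.
rewrite (le_trans (ler_wpM2r (unorm_ge0 _) (unormM _ _))) // mulrAC.
by rewrite ler_wpM2r ?unorm_ge0 // expr2 ler_pM ?unorm_ge0.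
Qed.

(** By partial fractions the resolvent of [x ^ (2 ^ k)] is an average of rotated
    copies of the resolvent of [x], so a Lipschitz constant of the latter serves
    for every [k]. *)
Lemma resolvent_pow_lipschitz x :
  (forall l : R[i], rnorm l <= 1 -> invertible (1 - l *: x)) ->
  exists2 L : R, 0 <= L & forall k, exists f : R[i] -> B,
    forall l : R[i], rnorm l <= 1 ->
      is_inverse (1 - (l *: x) ^+ (2 ^ k)) (f l) /\
      forall m : R[i], rnorm m <= 1 -> N (f l - f m) <= L * rnorm (l - m).
Proof.
move=> /resolvent_bounded[M MP].
exists (M ^+ 2 * N x); first by rewrite mulr_ge0 ?sqr_ge0 ?unorm_ge0.
elim=> [|k [f fP]].
  pose f l := xget 0 [set b | is_inverse (1 - l *: x) b /\ N b <= M]%classic.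
  have fP (l : R[i]) : rnorm l <= 1 -> is_inverse (1 - l *: x) (f l) /\ N (f l) <= M.
    move=> /MP[b b1 b2].
    have /(xgetPex 0) // : exists b, [set b | is_inverse (1 - l *: x) b /\ N b <= M]%classic b.
    by exists b.
  exists f => l /fP[l1 l2]; rewrite expn0 expr1; split => // m /fP[m1 m2].
  exact: inverse_distance.
have p2 : (0 < 2 ^ k)%N by rewrite expn_gt0.
(* Rotating [l] by [w] changes the sign of the power [(l x) ^ (2 ^ k)]. *)
pose w : R[i] := (2 ^ k)%N.-root (-1).
have wE : w ^+ (2 ^ k) = -1 by exact: rootCK.
have w1 : rnorm w = 1.
  have : rnorm w ^+ (2 ^ k) = 1 by rewrite -rnormX wE rnormN rnorm1.
  by move=> /eqP; rewrite pexpr_eq1 ?rnorm_ge0 // => /eqP.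
have rw (l : R[i]) : rnorm (w * l) = rnorm l by rewrite rnormM w1 mul1r.
exists (fun l => 2^-1 *: (f l + f (w * l))) => l l1.
have [invl lipl] := fP _ l1.
have [|invwl lipwl] := fP (w * l); first by rewrite rw.
split.
  rewrite expnSr exprM; apply: inverse_sqr_avg => //.
  by move: invwl; rewrite -scalerA exprZn wE scaleN1r opprK.
move=> m m1; rewrite -scalerBr unormZ opprD addrACA.
have -> : rnorm (2^-1 : R[i]) = 2^-1.
  by rewrite rnormV -[2]/(2%:R) -(rmorph_nat (real_complex R)) rnormC ger0_norm.
rewrite ler_pdivrMl // mulrDl mul1r (le_trans (unormD _ _)) // lerD //.
  exact: lipl.
by rewrite -[X in _ <= _ * X]rw mulrBr; apply: lipwl; rewrite rw.
Qed.

(** Rickart's elementary route to the spectral radius formula. If the powers of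
    [s x] stay bounded then those of [s' x], for [s'] a little less than [s],
    tend to [0], so the inverses of [1 - (s' x) ^ (2 ^ k)] tend to [1]; by
    equicontinuity the inverses at points a fixed distance further stay near [1],
    which keeps the powers bounded there. Finitely many steps lead from [0]
    to [1]. *)
Lemma bounded_powers x :
  (forall l : R[i], rnorm l <= 1 -> invertible (1 - l *: x)) ->
  exists k0, forall k, (k0 <= k)%N -> N (x ^+ (2 ^ k)) <= 2.
Proof.
move=> /resolvent_pow_lipschitz[L L0 LP].
pose bdd (s : R) := exists k0, forall k, (k0 <= k)%N ->
  N ((s%:C *: x) ^+ (2 ^ k)) <= 2.
(* Moving the parameter by [2 d] moves the inverses by at most [1/3]. *)
pose d : R := (6 * (L + 1))^-1.
have d0 : 0 < d by rewrite invr_gt0 mulr_gt0 // ltr_wpDl.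
have d1 : d < 1 by rewrite invf_lt1; [lra|nra].
have Ld : L * (2 * d) <= 3^-1.
  have : d * (6 * (L + 1)) = 1 by rewrite mulVf // gt_eqF // mulr_gt0 // ltr_wpDl.
  lra.
suff step j s : 0 <= s <= 1 -> s <= j%:R * d -> bdd s.
  have [||k0 k0P] := step (Num.truncn d^-1).+1 1 _ _.
  - by rewrite ler01 lexx.
  - by rewrite -ler_pdivrMr // mul1r ltW // truncnS_gt.
  by exists k0 => k /k0P; rewrite scale1r.
elim: j s => [|j IH] s /andP[s0 s1].
  rewrite mul0r => s0'; have -> : s = 0 by apply/eqP; rewrite eq_le s0' s0.
  exists 0%N => k _; rewrite scale0r expr0n expn_eq0 /= unorm0; lra.
rewrite -natr1 mulrDl mul1r => sj.
pose r := Num.max 0 (s - d).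
have r0 : 0 <= r by rewrite le_max lexx.
have r1 : r <= s by rewrite ge_max s0 gerBl ltW.
have [||k0 k0P] := IH r.
- by rewrite r0 (le_trans r1).
- by rewrite ge_max mulr_ge0 ?(ltW d0) //= lerBlDr.
(* The powers of [t r x] tend to [0], and [t r] lies within [2 d] of [s]: the
   shrinking by [t] and the passage from [r] to [s] each cost at most [d]. *)
pose t := 1 - d.
have t0 : 0 <= t by rewrite subr_ge0 ltW.
have tlim : ((GRing.exp t : nat -> R) @ \oo --> (0 : R))%classic.
  by apply: cvg_expr; rewrite ger0_norm // gtrBl.
have [k1 _ k1P] : (\forall k \near \oo, t ^+ k < 8^-1)%classic.
  by apply: (cvgr_lt (0 : R) tlim); rewrite invr_gt0.
exists (maxn k0 k1) => k; rewrite geq_max => /andP[/k0P powr k1k].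
have tpow : t ^+ (2 ^ k) <= 8^-1.
  by apply/ltW/k1P => /=; rewrite (leq_trans k1k) // ltnW // ltn_expl.
have powtr : N (((t * r)%:C *: x) ^+ (2 ^ k)) <= 4^-1.
  rewrite rmorphM -scalerA exprZn -rmorphXn unormC ger0_norm ?exprn_ge0 //.
  have := unorm_ge0 ((r%:C *: x) ^+ (2 ^ k)); nra.
have [f fP] := LP k.
have [|[b1 b2] lipf] := fP (t * r)%:C.
  by rewrite rnormC ger0_norm ?mulr_ge0 // mulr_ile1 // ?(le_trans r1) // gerBl ltW.
have [|[c1 c2] _] := fP s%:C; first by rewrite rnormC ger0_norm.
have {lipf} bc : N (f (t * r)%:C - f s%:C) <= 3^-1.
  apply: le_trans (lipf _ _) (le_trans _ Ld); first by rewrite rnormC ger0_norm.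
  rewrite ler_wpM2l // -rmorphB rnormC distrC.
  have rsd : s - d <= r by rewrite le_max lexx orbT.
  rewrite /t ger0_norm; last by nra.
  nra.
have yb : N (f (t * r)%:C - 1) <= 3^-1.
  have e : f (t * r)%:C - 1 = ((t * r)%:C *: x) ^+ (2 ^ k) * f (t * r)%:C.
    by move: b1; rewrite mulrBl mul1r => <-; rewrite opprB addrC subrK.
  have := unormD 1 (f (t * r)%:C - 1); rewrite [1 + _]addrC subrK unorm1.
  have := unormM (((t * r)%:C *: x) ^+ (2 ^ k)) (f (t * r)%:C).
  rewrite -e; have := unorm_ge0 (f (t * r)%:C); nra.
have c1' : N (f s%:C - 1) <= 2 / 3.
  have := unormD (f s%:C - f (t * r)%:C) (f (t * r)%:C - 1).
  by rewrite addrA subrK unorm_distC => le; lra.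
set y := (s%:C *: x) ^+ (2 ^ k) in c1 *; set c := f s%:C in c1 c1'.
have yE : y = (c - 1) - y * (c - 1).
  have yc : y * c = c - 1.
    by move: c1; rewrite mulrBl mul1r => <-; rewrite opprB addrC subrK.
  by rewrite mulrBr mulr1 yc opprB addrC subrK.
have : N y <= N (c - 1) + N y * N (c - 1).
  rewrite {1}yE (le_trans (unormB _ _)) // lerD2l; exact: unormM.
have := unorm_ge0 y; nra.
Qed.

End SpectralRadius.

(** * Spectrum and norm of selfadjoint elements *)

Section Positivity.
Variables (R : realType) (B : unitalCstarType R).
Local Notation N := (@unorm R B).
Local Notation st := (@ustar R B).
Implicit Types a b c h x : B.

Lemma selfadjoint_normX x k : st x = x -> N (x ^+ (2 ^ k)) = N x ^+ (2 ^ k).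
Proof.
move=> sx; elim: k => [|k IH]; first by rewrite expn0 !expr1.
by rewrite expnSr !exprM -IH -unorm_star_mul ustarX sx -expr2.
Qed.

(** Norm and spectral radius agree on selfadjoint elements. If [N x] exceeded [t],
    a rescaling [y] of [x] by a number between them would have norm more than [1]
    and no spectrum outside the open unit disc; its powers would then be bounded
    and yet have norms [N y ^ (2 ^ k)]. *)
Lemma selfadjoint_norm_le x (t : R) : st x = x -> 0 <= t ->
  (forall l : R[i], t < rnorm l -> invertible (x - l%:A)) -> N x <= t.
Proof.
move=> sx t0 inv_x; rewrite leNgt; apply/negP => tx.
pose s := (t + N x) / 2.
have ts : t < s by rewrite /s; lra.
have sN : s < N x by rewrite /s; lra.
have s0 : 0 < s by apply: le_lt_trans ts.
pose y := (s^-1)%:C *: x.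
have Ny : N y = s^-1 * N x by rewrite unormC ger0_norm // invr_ge0 ltW.
have Ny1 : 1 < N y by rewrite Ny ltr_pdivlMl // mulr1.
have sy : st y = y by rewrite ustar_real sx.
have [|k0 k0P] := @bounded_powers R B y.
  move=> l l1; have [->|l0] := eqVneq l 0.
    by rewrite scale0r subr0; exists 1; split; rewrite mulr1.
  have ls0 : l * (s^-1)%:C != 0.
    by rewrite mulf_neq0 // (inj_eq (@complexI R)) gt_eqF // invr_gt0.
  have -> : 1 - l *: y = - (l * (s^-1)%:C) *: (x - (l * (s^-1)%:C)^-1%:A).
    by rewrite scaleNr scalerBr [X in - (_ - X)]scalerA mulfV // scale1r opprB -scalerA.
  apply: invertibleZ; first by rewrite oppr_eq0.
  apply: inv_x; apply: (lt_le_trans ts).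
  rewrite rnormV rnormM rnormC ger0_norm ?invr_ge0 ?(ltW s0) // invfM invrK.
  have lp : 0 < rnorm l.
    rewrite lt_def rnorm_ge0 andbT; apply: contraNneq l0 => l0.
    by apply/eqP; exact: rnorm0_eq0.
  by rewrite ler_peMl ?(ltW s0) // invf_ge1.
have qlim : ((GRing.exp (N y)^-1 : nat -> R) @ \oo --> (0 : R))%classic.
  apply: cvg_expr; rewrite ger0_norm ?invr_ge0 ?unorm_ge0 // invf_lt1 //.
  exact: lt_trans Ny1.
have [k1 _ k1P] : (\forall k \near \oo, (N y)^-1 ^+ k < 2^-1)%classic.
  by apply: (cvgr_lt (0 : R) qlim); rewrite invr_gt0.
have := k0P (maxn k0 k1) (leq_maxl _ _); rewrite selfadjoint_normX //.
set m := (2 ^ _)%N; have /k1P /= : (k1 <= m)%N.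
  by rewrite (leq_trans (leq_maxr k0 _)) // ltnW // ltn_expl.
rewrite exprVn ltf_pV2 ?posrE ?exprn_gt0 ?(lt_trans _ Ny1) //.
by rewrite ltNge => /negP.
Qed.

Lemma ustar_scalar (l : R[i]) : st l%:A = (Num.conj l)%:A.
Proof. by rewrite ustarZ ustar1. Qed.

(** Adding [i m] to the selfadjoint [a] raises the squared norm by at most [m ^ 2],
    but moves a point [i u] to a point of squared modulus [(u + m) ^ 2], which for
    [m] large of the sign of [u] is beyond that norm. *)
Lemma selfadjoint_nonreal x (l : R[i]) : st x = x -> complex.Im l != 0 ->
  invertible (x - l%:A).
Proof.
move=> sx; case: l => s u /= u0.
pose a := x - s%:C%:A.
have sa : st a = a by rewrite ustarB sx ustar_scalar conjC_real.
(* With this [m] one has [(u + m) ^ 2 = u ^ 2 + N a ^ 2 + m ^ 2]. *)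
pose m := N a ^+ 2 / (2 * u).
pose p := a + (0 +i* m)%:A.
have pE : st p * p = a * a + (m ^+ 2)%:C%:A.
  rewrite ustarD sa ustar_scalar.
  have -> : Num.conj (0 +i* m : R[i]) = - (0 +i* m).
    by apply/eqP; rewrite eq_complex /= oppr0 !eqxx.
  rewrite scaleNr /p; set j := (0 +i* m)%:A.
  have ja : j * a = a * j by rewrite mulr_algl mulr_algr.
  have jj : - (j * j) = (m ^+ 2)%:C%:A.
    rewrite mulr_algl scalerA -scaleNr; congr (_ *: _).
    by apply/eqP; rewrite eq_complex /= expr2; apply/andP; split; apply/eqP; ring.
  by rewrite mulrDr (mulrBl a a j) (mulrBl j a j) ja addrA subrK jj.
have pN : N p ^+ 2 <= N a ^+ 2 + m ^+ 2.
  rewrite -unorm_star_mul pE (le_trans (unormD _ _)) // lerD //.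
    by rewrite expr2 unormM.
  by rewrite unorm_scalar rnormC ger0_norm ?sqr_ge0.
have um : 2 * u * m = N a ^+ 2 by rewrite /m mulrC divfK // mulf_neq0 ?pnatr_eq0.
have -> : x - (s +i* u)%:A = - ((0 +i* (u + m))%:A - p).
  rewrite opprB /p /a -!addrA; congr (_ + _).
  rewrite -!scaleNr -!scalerDl; congr (_ *: _).
  by apply/eqP; rewrite eq_complex /=; apply/andP; split; apply/eqP; ring.
apply/invertibleN/neumann_scalar.
rewrite -(ltr_pXn2r (n := 2)) ?nnegrE ?unorm_ge0 ?rnorm_ge0 // rnorm_sqr /=.
have : 0 < u ^+ 2 by rewrite exprn_even_gt0.
by move: um pN; nra.
Qed.

(** * Positive elements and square roots *)

Definition upositive a : Prop :=
  st a = a /\ forall l : R[i], ~ invertible (a - l%:A) -> 0 <= l.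

(** This criterion and the next lemma trade the spectral definition for a
    condition on the norm, which behaves well under sums and limits. *)
Lemma upositive_of_norm a (t : R) : st a = a -> N (t%:C%:A - a) <= t ->
  upositive a.
Proof.
move=> sa at_le; split=> // -[r u] ninv.
have [u0|u0] := eqVneq u 0; last by case: ninv; apply: selfadjoint_nonreal.
rewrite u0 in ninv *; rewrite lecE /= eqxx /= leNgt; apply/negP => r0.
apply: ninv; have -> : a - (r +i* 0)%:A = (t - r)%:C%:A - (t%:C%:A - a).
  by rewrite rmorphB scalerBl opprB [RHS]addrC addrA subrK.
apply: neumann_scalar; rewrite rnormC; apply: le_lt_trans at_le _.
by apply: lt_le_trans (ler_norm _); rewrite ltrBrDr gtrDl.
Qed.

Lemma norm_upositive a (t : R) : upositive a -> N a <= t -> N (t%:C%:A - a) <= t.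
Proof.
move=> [sa pa] at_le; have t0 : 0 <= t by apply: le_trans at_le; exact: unorm_ge0.
apply: selfadjoint_norm_le => // [|l tl].
  by rewrite ustarB ustar_scalar conjC_real sa.
have -> : t%:C%:A - a - l%:A = - (a - (t%:C - l)%:A).
  by rewrite scalerBl !opprB addrAC addrC.
apply: invertibleN; apply: contrapT => /[dup] /pa tl0 []; rewrite -opprB.
apply: invertibleN; apply: neumann_scalar; apply: le_lt_trans at_le _.
move: tl0 tl; case: l => r u; rewrite lecE /= sub0r oppr_eq0 => /andP[/eqP -> rt].
rewrite [_ +i* 0]/(r%:C) -rmorphB !rnormC => tr.
rewrite (ger0_norm rt); move: tr.
by case: (ltrP r 0) => r0; [rewrite ltr0_norm|rewrite ger0_norm] => // tr; lra.
Qed.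

Lemma upositiveD a b : upositive a -> upositive b -> upositive (a + b).
Proof.
move=> pa pb; apply: (@upositive_of_norm _ (N a + N b)).
  by rewrite ustarD pa.1 pb.1.
rewrite rmorphD scalerDl opprD addrACA (le_trans (unormD _ _)) //.
by rewrite lerD // norm_upositive.
Qed.

Lemma upositiveZ (r : R) a : 0 <= r -> upositive a -> upositive (r%:C *: a).
Proof.
move=> r0 pa; apply: (@upositive_of_norm _ (r * N a)).
  by rewrite ustar_real pa.1.
rewrite rmorphM -scalerA -scalerBr unormC ger0_norm // ler_wpM2l //.
exact: norm_upositive.
Qed.

(** The spectrum can only contain [0], so the norm vanishes. *)
Lemma upositive_anti a : upositive a -> upositive (- a) -> a = 0.
Proof.
move=> [sa pa] [_ na]; apply: unorm0_eq0; apply/eqP.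
rewrite eq_le unorm_ge0 andbT; apply: selfadjoint_norm_le => // l l0.
apply: contrapT => /[dup] /pa l_ge0 ninv.
have : 0 <= - l.
  apply: na; rewrite scaleNr -opprD => /invertibleN; rewrite opprK.
  exact: ninv.
rewrite oppr_ge0 => l_le0; have : l = 0 by apply/eqP; rewrite eq_le l_le0.
by move=> l00; rewrite l00 rnorm0 ltxx in l0.
Qed.

End Positivity.


Section SquareRoots.
Variables (R : realType) (B : unitalCstarType R).
Local Notation N := (@unorm R B).
Local Notation st := (@ustar R B).
Implicit Types a b c h x : B.

(** [1 - b] is the limit [y] of the iteration [u := (x + u ^ 2) / 2], which
    satisfies [2 y = x + y ^ 2], that is [(1 - y) ^ 2 = 1 - x]. The increments of
    [u] are dominated by those of the same iteration on numbers, with [1] in place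
    of [x], which is a monotone sequence bounded by [1]. Commutation with
    whatever commutes with [x] is what makes products of roots manageable in
    [upositive_star_mul]. *)
Lemma sqrt_one_sub x : st x = x -> N x <= 1 ->
  exists b, [/\ st b = b, N (1 - b) <= 1, b * b = 1 - x &
    forall c, c * x = x * c -> c * b = b * c].
Proof.
move=> sx x1.
pose u := fix u n : B :=
  if n is m.+1 then (2^-1)%:C *: (x + u m * u m) else 0.
pose r := fix r n : R := if n is m.+1 then 2^-1 * (1 + r m * r m) else 0.
have r01 n : 0 <= r n <= 1 by elim: n => [|n /andP[? ?]] /=; nra.
have half : `|2^-1 : R| = 2^-1 by rewrite ger0_norm // invr_ge0.
have ur n : N (u n) <= r n.
  elim: n => [|n IH] /=; first by rewrite unorm0.
  rewrite unormC half ler_wpM2l ?invr_ge0 // (le_trans (unormD _ _)) // lerD //.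
  by rewrite (le_trans (unormM _ _)) // ler_pM ?unorm_ge0.
have dur n : N (u n.+1 - u n) <= r n.+1 - r n.
  elim: n => [|n IH].
    by rewrite /= !mulr0 !addr0 !subr0 unormC half ler_wpM2l ?invr_ge0.
  have -> : u n.+2 - u n.+1 =
      (2^-1)%:C *: (u n.+1 * (u n.+1 - u n) + (u n.+1 - u n) * u n).
    rewrite [LHS](_ : _ = (2^-1)%:C *: (x + u n.+1 * u n.+1) -
      (2^-1)%:C *: (x + u n * u n)) // -scalerBr; congr (_ *: _).
    by rewrite opprD addrACA subrr add0r mulrBr mulrBl addrA subrK.
  have -> : r n.+2 - r n.+1 =
      2^-1 * (r n.+1 * (r n.+1 - r n) + (r n.+1 - r n) * r n).
    rewrite [LHS](_ : _ = 2^-1 * (1 + r n.+1 * r n.+1) -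
      2^-1 * (1 + r n * r n)) //; move: (r n.+1) (r n) => p q; ring.
  rewrite unormC half ler_wpM2l ?invr_ge0 // (le_trans (unormD _ _)) // lerD //.
    by rewrite (le_trans (unormM _ _)) // ler_pM ?unorm_ge0.
  by rewrite (le_trans (unormM _ _)) // ler_pM ?unorm_ge0.
have [|y uy] := dominated_conv dur (M := 1); first by move=> n; case/andP: (r01 n).
have yE : y = (2^-1)%:C *: (x + y * y).
  apply: (uconv_unique (uconv_shift uy)) => /=.
  by apply/uconvZ/uconvD; [exact: uconv_cst|exact: uconvM].
have yx : y + y = x + y * y.
  by rewrite {1 2}yE -scalerDl -rmorphD -[2^-1]mul1r -splitr scale1r.
have sy : st y = y.
  apply: (uconv_unique _ uy); have := uconv_star uy.
  have su n : st (u n) = u n.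
    by elim: n => [|n IH] /=; rewrite ?ustar0 // ustar_real ustarD sx ustarM IH.
  by under eq_fun do rewrite su.
exists (1 - y); split.
- by rewrite ustarB ustar1 sy.
- rewrite opprB addrC subrK; apply: uconv_norm_le uy => n.
  by rewrite (le_trans (ur n)) //; case/andP: (r01 n).
- rewrite mulrBr mulr1 mulrBl mul1r opprB.
  have -> : y * y = (y + y) - x by rewrite yx addrAC subrr add0r.
  by rewrite [_ - x - y]addrAC addrK addrA subrK.
- move=> c cx; rewrite mulrBr mulrBl mulr1 mul1r; congr (_ - _).
  have cu n : c * u n = u n * c.
    elim: n => [|n IH] /=; first by rewrite mulr0 mul0r.
    by rewrite -scalerAr -scalerAl mulrDr mulrDl cx mulrA IH -mulrA IH mulrA.
  apply: (@uconv_unique R B (fun n => c * u n)).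
    by apply: uconvM => //; exact: uconv_cst.
  by under eq_fun do rewrite cu; apply: uconvM => //; exact: uconv_cst.
Qed.

Lemma upositive_sqrt a : upositive a ->
  exists b, [/\ upositive b, b * b = a & forall c, c * a = a * c -> c * b = b * c].
Proof.
move=> pa; pose t := N a + 1.
have t0 : 0 < t by rewrite ltr_wpDl // unorm_ge0.
have ti0 : 0 <= t^-1 by rewrite invr_ge0 ltW.
have tt : (t^-1)%:C *: (t%:C%:A : B) = 1.
  by rewrite scalerA -rmorphM mulVf ?gt_eqF // scale1r.
have [||b [sb b1 bb bc]] := @sqrt_one_sub ((t^-1)%:C *: (t%:C%:A - a)).
- by rewrite ustar_real ustarB ustar_scalar conjC_real pa.1.
- rewrite unormC ger0_norm // ler_pdivrMl // mulr1 norm_upositive //.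
  by rewrite lerDl.
have pb : upositive b by apply: (@upositive_of_norm _ _ _ 1) => //; rewrite scale1r.
exists ((Num.sqrt t)%:C *: b); split.
- by apply: upositiveZ => //; exact: sqrtr_ge0.
- rewrite -scalerAl -scalerAr scalerA -rmorphM -expr2 sqr_sqrtr ?ltW // bb.
  rewrite (scalerBr (t^-1)%:C) tt opprB addrC subrK scalerA -rmorphM mulfV ?gt_eqF //.
  by rewrite scale1r.
- move=> c ca; rewrite -scalerAl -scalerAr bc //.
  by rewrite -scalerAl -scalerAr mulrBl mulrBr ca mulr_algl mulr_algr.
Qed.

(** [h ^ 2 - m ^ 2 = (h - m) (h + m)] is invertible when [m] is not real. *)
Lemma upositive_sqr h : st h = h -> upositive (h * h).
Proof.
move=> sh; split=> [|l ninv]; first by rewrite ustarM sh.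
pose m := sqrtC l; have mm : m * m = l by rewrite -expr2 sqrtCK.
have [m0|m0] := eqVneq (complex.Im m) 0.
  have mr : m \is Num.real by case: (m) m0 => r u /= ->; rewrite complex_real.
  by rewrite -mm -expr2 real_exprn_even_ge0.
case: ninv; have -> : h * h - l%:A = (h - m%:A) * (h - (- m)%:A).
  rewrite scaleNr opprK mulrDr !mulrBl mulr_algl mulr_algr addrA subrK.
  by rewrite mulr_algl scalerA mm.
apply: invertibleM; apply: selfadjoint_nonreal => //.
by move: m0; case: (m) => r u /=; rewrite oppr_eq0.
Qed.

(** Formally [(1 + b a)^-1 = 1 - b (1 + a b)^-1 a], by expanding both sides into
    geometric series. *)
Lemma invertible_one_add_swap a b : invertible (1 + a * b) -> invertible (1 + b * a).
Proof.
move=> [d [ed de]]; exists (1 - b * d * a).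
have eb : (1 + b * a) * b = b * (1 + a * b).
  by rewrite mulrDl mulrDr mul1r mulr1 mulrA.
have ea : a * (1 + b * a) = (1 + a * b) * a.
  by rewrite mulrDl mulrDr mul1r mulr1 mulrA.
split.
  by rewrite mulrBr mulr1 !mulrA eb -(mulrA b) ed mulr1 addrK.
by rewrite mulrBl mul1r -!mulrA ea (mulrA d) de mul1r addrK.
Qed.

Lemma upositive_opp_swap c : upositive (- (st c * c)) -> upositive (- (c * st c)).
Proof.
move=> [_ pc]; split=> [|l ninv]; first by rewrite ustarN ustarM ustarK.
have [->//|l0] := eqVneq l 0; apply: pc; apply: contra_not ninv.
have e a b : - (a * b) - l%:A = (- l) *: (1 + (l^-1 *: a) * b).
  by rewrite scalerDr -scalerAl scalerA mulNr mulfV // !scaleNr scale1r addrC.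
rewrite [X in invertible X -> _]e [X in _ -> invertible X]e => inv.
apply: invertibleZ; rewrite ?oppr_eq0 // -scalerAl scalerAr.
apply: invertible_one_add_swap.
have := @invertibleZ R B (- l)^-1 _ _ inv; rewrite scalerA mulVf ?oppr_eq0 //.
by rewrite scale1r -scalerAl scalerAr; apply; rewrite invr_eq0 oppr_eq0.
Qed.

Lemma star_mul_eq0 c : st c * c = 0 -> c = 0.
Proof.
move=> cc; apply: unorm0_eq0; apply/eqP.
by rewrite -[_ == 0](@sqrf_eq0 R) -unorm_star_mul cc unorm0.
Qed.

(** If [- c^* c] is positive then so is [- c c^*], while for the real and imaginary
    parts [u], [v] of [c] the sum [u ^ 2 + v ^ 2] is proportional to
    [c^* c + c c^*]. Hence [c^* c] is positive too, and vanishes. *)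
Lemma star_mul_nonpositive c : upositive (- (st c * c)) -> c = 0.
Proof.
move=> nc; apply/star_mul_eq0/upositive_anti => //.
have nc' := upositive_opp_swap nc.
pose u := c + st c; pose v := 'i%R *: (c - st c).
have su : st u = u by rewrite ustarD ustarK addrC.
have sv : st v = v by rewrite ustarZ conjCi ustarB ustarK scaleNr -scalerN opprB.
have sqD a b : (a + b) * (a + b) = (a * a + b * b) + (a * b + b * a).
  by rewrite mulrDl !mulrDr addrA -(addrA (a * a)) addrAC.
have sqB a b : (a - b) * (a - b) = (a * a + b * b) - (a * b + b * a).
  by rewrite mulrBl !mulrBr opprB addrACA -opprD.
have vv : v * v = - ((c - st c) * (c - st c)).
  by rewrite /v -scalerAl -scalerAr scalerA -expr2 sqrCi scaleN1r.
have -> : st c * c = (2^-1)%:C *: (u * u + v * v) + - (c * st c).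
  rewrite vv /u sqD sqB opprD opprK addrACA subrr add0r scalerDr -scalerDl -rmorphD.
  by rewrite -[2^-1]mul1r -splitr scale1r addrAC subrr add0r.
apply: upositiveD => //; apply: upositiveZ; first by rewrite invr_ge0.
by apply: upositiveD; exact: upositive_sqr.
Qed.

(** The element [w = |h| - h] satisfies [w h = - |h| w]. So
    [(c w)^* (c w) = w h w = - (w q) ^ 2], where [q] is the root of [|h|], and
    therefore [c w = 0]. Then [w q = 0], hence [w ^ 2 = w |h| - w h = 0]. *)
Theorem upositive_star_mul c : upositive (st c * c).
Proof.
set h := st c * c; have sh : st h = h by rewrite ustarM ustarK.
have [k [pk kk kc]] := upositive_sqrt (upositive_sqr sh).
have hk : h * k = k * h by apply: kc; rewrite mulrA.
have [q [pq qq qc]] := upositive_sqrt pk.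
pose w := k - h.
have sw : st w = w by rewrite ustarB sh pk.1.
have wk : w * k = k * w by rewrite mulrBl mulrBr hk.
have wq : w * q = q * w by exact: qc.
have wh : w * h = - (k * w) by rewrite mulrBl mulrBr kk opprB.
have cw : st (c * w) * (c * w) = - ((w * q) * (w * q)).
  rewrite ustarM sw; have -> : w * st c * (c * w) = w * h * w by rewrite /h !mulrA.
  rewrite wh mulNr; congr (- _).
  have -> : k * w * w = w * (w * k) by rewrite wk mulrA wk.
  by rewrite -qq -[RHS]mulrA; congr (w * _); rewrite mulrA wq -mulrA wq.
have swq : st (w * q) = w * q by rewrite ustarM sw pq.1.
have cw0 : c * w = 0.
  by apply: star_mul_nonpositive; rewrite cw opprK; apply: upositive_sqr.
have wq0 : w * q = 0.
  apply: star_mul_eq0; rewrite swq; apply/eqP; rewrite -oppr_eq0 -cw cw0.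
  by rewrite mulr0.
have kw0 : k * w = 0 by rewrite -wk -qq mulrA wq0 mul0r.
have w0 : w = 0.
  by apply: star_mul_eq0; rewrite sw /w mulrBr -/w wk kw0 wh kw0 oppr0 subrr.
by move: pk; rewrite -[k](subrK h) -/w w0 add0r.
Qed.

Lemma upositive_conj h c : upositive h -> upositive (st c * h * c).
Proof.
move=> /upositive_sqrt[k [[sk _] <- _]].
by rewrite -{1}sk mulrA -ustarM -mulrA; apply: upositive_star_mul.
Qed.

End SquareRoots.

(** * The unitization as a unital C*-algebra *)

Section NormedCompleteness.
Variable R : realType.

Lemma rnorm_complete (V : completeNormedModType R[i]) (u : nat -> V) :
  (forall e : R, 0 < e ->
     exists n0, forall m n, (n0 <= m)%N -> (n0 <= n)%N -> rnorm (u m - u n) < e) ->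
  exists l, forall e : R, 0 < e ->
     exists n0, forall n, (n0 <= n)%N -> rnorm (u n - l) < e.
Proof.
move=> cau.
have gt0E (e : R[i]) : 0 < e -> exists2 r : R, 0 < r & e = r%:C.
  case: e => r s; rewrite ltcE /= => /andP[/eqP -> r0].
  by exists r.
have /cauchy_cvgP/cvg_ex[l ul] : cauchy (u @ \oo)%classic.
  apply: cauchy_exP => _ /gt0E[r r0 ->]; have [n0 n0P] := cau _ r0.
  exists (u n0); exists n0 => // n /= n0n.
  by rewrite -ball_normE /= rnormE ltcR n0P.
exists l => e e0.
have [|n0 _ n0P] := (cvgrPdist_lt _ _).1 ul e%:C; first by rewrite ltcR.
exists n0 => n /n0P /=; rewrite rnormE ltcR -(rnormN (u n - l)) opprB.
exact.
Qed.

Lemma real_complete (u : nat -> R) :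
  (forall e : R, 0 < e ->
     exists n0, forall m n, (n0 <= m)%N -> (n0 <= n)%N -> `|u m - u n| < e) ->
  exists l, forall e : R, 0 < e ->
     exists n0, forall n, (n0 <= n)%N -> `|u n - l| < e.
Proof.
move=> cau.
have /cauchy_cvgP/cvg_ex[l /cvgrPdist_lt ul] : cauchy (u @ \oo)%classic.
  apply: cauchy_exP => r r0; have [n0 n0P] := cau _ r0.
  by exists (u n0); exists n0 => // n /= n0n; rewrite /ball /= n0P.
exists l => e /ul[n0 _ n0P].
by exists n0 => n /n0P /=; rewrite distrC.
Qed.

Lemma complex_complete (u : nat -> R[i]) :
  (forall e : R, 0 < e ->
     exists n0, forall m n, (n0 <= m)%N -> (n0 <= n)%N -> rnorm (u m - u n) < e) ->
  exists l, forall e : R, 0 < e ->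
     exists n0, forall n, (n0 <= n)%N -> rnorm (u n - l) < e.
Proof.
move=> cau.
have [|a aP] := @real_complete (fun n => complex.Re (u n)).
  move=> e /cau[n0 n0P]; exists n0 => m n m0 m1; rewrite -raddfB.
  by apply: le_lt_trans (n0P _ _ m0 m1); exact: (coord_le_rnorm _).1.
have [|b bP] := @real_complete (fun n => complex.Im (u n)).
  move=> e /cau[n0 n0P]; exists n0 => m n m0 m1; rewrite -raddfB.
  by apply: le_lt_trans (n0P _ _ m0 m1); exact: (coord_le_rnorm _).2.
exists (a +i* b) => e e0; have e20 : 0 < e / 2 by rewrite divr_gt0.
have [n0 n0P] := aP _ e20; have [n1 n1P] := bP _ e20.
exists (maxn n0 n1) => n; rewrite geq_max => /andP[/n0P h0 /n1P h1].
rewrite [e]splitr (le_lt_trans (rnorm_le_coord _)) // !raddfB.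
exact: ltrD.
Qed.

End NormedCompleteness.

Section Unitization.
Variables (R : realType) (A : cstarAlgType R).

Definition unitization : Type := (A * R[i])%type.
HB.instance Definition _ := GRing.Lmodule.copy unitization (A * R[i]^o)%type.

Implicit Types p q : unitization.

Let one : unitization := (0, 1).
Let mul p q : unitization := unitization_mul p q.

Lemma cmul0l (b : A) : cmul 0 b = 0.
Proof. by apply: (addIr (cmul 0 b)); rewrite -cmulDl !add0r. Qed.

Lemma cmul0r (b : A) : cmul b 0 = 0.
Proof. by apply: (addIr (cmul b 0)); rewrite -cmulDr !add0r. Qed.

Lemma star0 : star (0 : A) = 0.
Proof. by apply: (addIr (star 0)); rewrite -starD !add0r. Qed.

Let unit_mulA : associative mul.
Proof.
move=> [a l] [b m] [c n]; congr (_, _) => /=; last exact: mulrA.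
rewrite !cmulDr !cmulDl !cmulZl !cmulZr !scalerDr !scalerA cmulA !addrA.
by rewrite [RHS](ACl (1*3*5*2*4*6*7)) (mulrC l n) (mulrC m n).
Qed.

Let unit_mul1 : left_id one mul.
Proof.
by move=> [a l]; rewrite /mul /unitization_mul /= cmul0l add0r scale1r scaler0 addr0 mul1r.
Qed.

Let unit_mulr1 : right_id one mul.
Proof.
by move=> [a l]; rewrite /mul /unitization_mul /= cmul0r add0r scale1r scaler0 add0r mulr1.
Qed.

Let unit_mulDl : left_distributive mul +%R.
Proof.
move=> [a l] [b m] [c n]; congr (_, _) => /=; last exact: mulrDl.
rewrite cmulDl scalerDl scalerDr !addrA.
by rewrite [RHS](ACl (1*4*2*5*3*6)).
Qed.

Let unit_mulDr : right_distributive mul +%R.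
Proof.
move=> [a l] [b m] [c n]; congr (_, _) => /=; last exact: mulrDr.
rewrite cmulDr scalerDl scalerDr !addrA.
by rewrite [RHS](ACl (1*4*2*5*3*6)).
Qed.

Let unit_one_neq0 : one != 0.
Proof. by apply/negP => /eqP[] /eqP; rewrite oner_eq0. Qed.

HB.instance Definition _ := GRing.Zmodule_isNzRing.Build unitization
  unit_mulA unit_mul1 unit_mulr1 unit_mulDl unit_mulDr unit_one_neq0.

Let unit_scaleAl (k : R[i]) p q : k *: (p * q) = (k *: p) * q.
Proof.
case: p q => [a l] [b m]; congr (_, _) => /=; last exact: mulrA.
by rewrite !scalerDr !scalerA cmulZl (mulrC k m).
Qed.

Let unit_scaleAr (k : R[i]) p q : k *: (p * q) = p * (k *: q).
Proof.
case: p q => [a l] [b m]; congr (_, _) => /=; last exact: mulrCA.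
by rewrite !scalerDr !scalerA cmulZr (mulrC k l).
Qed.

HB.instance Definition _ :=
  GRing.Lmodule_isLalgebra.Build R[i] unitization unit_scaleAl.
HB.instance Definition _ :=
  GRing.Lalgebra_isAlgebra.Build R[i] unitization unit_scaleAr.

Lemma unitization_mulE p q :
  p * q = (cmul p.1 q.1 + p.2 *: q.1 + q.2 *: p.1, p.2 * q.2).
Proof. by []. Qed.

(** Left multiplication by an element of the unitization preserves [A], which
    is an ideal; the norm is built from this representation. *)
Definition uact p (b : A) : A := cmul p.1 b + p.2 *: b.

Lemma uactM p q b : uact (p * q) b = uact p (uact q b).
Proof.
rewrite /uact unitization_mulE /= !cmulDl !cmulDr !cmulZl !cmulZr !scalerDr.
by rewrite !scalerA cmulA !addrA (ACl (1*3*2*4)).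
Qed.

Lemma uactD p q b : uact (p + q) b = uact p b + uact q b.
Proof. by rewrite /uact /= cmulDl scalerDl addrACA. Qed.

Lemma uactZ (l : R[i]) p b : uact (l *: p) b = l *: uact p b.
Proof. by rewrite /uact /= cmulZl scalerDr scalerA. Qed.

Definition unitization_star p : unitization := (star p.1, Num.conj p.2).
Local Notation st := unitization_star.

Lemma star_uact p b c : cmul (star (uact p b)) c = cmul (star b) (uact (st p) c).
Proof.
by rewrite /uact starD starM starZ cmulDl cmulDr cmulZl cmulZr cmulA.
Qed.

Lemma rnorm_cmul (a b : A) : rnorm (cmul a b) <= rnorm a * rnorm b.
Proof. by rewrite -lecR rmorphM /= -!rnormE norm_cmul. Qed.

Lemma rnorm_star_cmul (a : A) : rnorm (cmul (star a) a) = rnorm a ^+ 2.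
Proof. by apply: complexI; rewrite rmorphXn /= -!rnormE norm_star_cmul. Qed.

Lemma rnorm_star (a : A) : rnorm (star a) = rnorm a.
Proof.
have le (b : A) : rnorm b <= rnorm (star b).
  have := rnorm_cmul (star b) b; rewrite rnorm_star_cmul expr2.
  have := rnorm_ge0 b; rewrite le_eqVlt => /predU1P[<- _|b0]; last by rewrite ler_pM2r.
  exact: rnorm_ge0.
by apply/eqP; rewrite eq_le le -{2}[a]starK le.
Qed.

(** The norm of [a + l 1] is the larger of [|l|] and of the norm of its action
    on [A] by left multiplication. Including [|l|] makes this a norm also when [A]
    has a unit of its own, where the action alone is not faithful; both parts
    satisfy the C*-identity, hence so does their maximum. *)
Definition bounded_by p (K : R) : Prop :=
  (forall b, rnorm (uact p b) <= K * rnorm b) /\ rnorm p.2 <= K.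

Definition unitization_norm p : R := inf [set K | bounded_by p K]%classic.
Local Notation N := unitization_norm.

Lemma bounded_by_ge0 p K : bounded_by p K -> 0 <= K.
Proof. by move=> [_]; apply: le_trans; exact: rnorm_ge0. Qed.

Let has_bound p : bounded_by p (rnorm p.1 + rnorm p.2).
Proof.
split=> [b|]; last by rewrite lerDr rnorm_ge0.
by rewrite (le_trans (rnormD _ _)) // mulrDl lerD ?rnorm_cmul // rnormZ.
Qed.

Let has_inf_bound p : has_inf [set K | bounded_by p K]%classic.
Proof.
split; first by exists (rnorm p.1 + rnorm p.2); exact: has_bound.
by exists 0 => K; exact: bounded_by_ge0.
Qed.

Lemma unitization_norm_le p K : bounded_by p K -> N p <= K.
Proof. by move=> pK; apply: ge_inf => //; exact: (has_inf_bound p).2. Qed.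

Lemma bounded_by_norm p : bounded_by p (N p).
Proof.
have adh e : 0 < e -> exists2 K, bounded_by p K & K < N p + e.
  by move=> e0; exact: inf_adherent e0 (has_inf_bound p).
split=> [b|]; last first.
  by apply/ler_addgt0Pr => e /adh[K [_ pK] /ltW]; exact: le_trans.
apply/ler_addgt0Pr => e e0.
have b0 : 0 < rnorm b + 1 by rewrite ltr_wpDl ?rnorm_ge0.
have [|K [pK _] KN] := adh (e / (rnorm b + 1)); first by rewrite divr_gt0.
apply: le_trans (pK b) _.
apply: (@le_trans _ _ ((N p + e / (rnorm b + 1)) * rnorm b)).
  by rewrite ler_wpM2r ?rnorm_ge0 // ltW.
rewrite mulrDl lerD2l -mulrA ger_pMr // mulrC ler_pdivrMr // mul1r.
by rewrite lerDl.
Qed.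

Lemma norm_element_le (a : A) : N (a, 0) <= rnorm a.
Proof. by apply: unitization_norm_le; have := has_bound (a, 0); rewrite /= rnorm0 addr0. Qed.

(** With [has_bound], this shows that the norm is equivalent to the sum of the
    norms of the components, from which it inherits completeness. *)
Lemma rnorm_fst_le p : rnorm p.1 <= 2 * N p.
Proof.
have [bp lp] := bounded_by_norm p.
have le b : rnorm (cmul p.1 b) <= 2 * N p * rnorm b.
  have -> : cmul p.1 b = uact p b - p.2 *: b by rewrite /uact addrK.
  rewrite (le_trans (rnormD _ _)) // rnormN rnormZ -mulrA mulrDl mul1r lerD //.
  by rewrite ler_wpM2r ?rnorm_ge0.
have := le (star p.1); rewrite -{1}[p.1]starK rnorm_star_cmul rnorm_star expr2.
have := rnorm_ge0 p.1; rewrite le_eqVlt => /predU1P[<- _|p0]; last by rewrite ler_pM2r.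
by rewrite mulr_ge0 // (bounded_by_ge0 (bounded_by_norm p)).
Qed.

Let starD' p q : st (p + q) = st p + st q.
Proof. by rewrite /st /= starD rmorphD. Qed.

Let starZ' (l : R[i]) p : st (l *: p) = Num.conj l *: st p.
Proof. by rewrite /st /= starZ rmorphM. Qed.

Let starM' p q : st (p * q) = st q * st p.
Proof.
rewrite /st !unitization_mulE /= !starD starM !starZ rmorphM addrAC.
by rewrite [_ * _]mulrC.
Qed.

Let starK' p : st (st p) = p.
Proof. by case: p => a l; rewrite /st /= starK conjCK. Qed.

Let normD' p q : N (p + q) <= N p + N q.
Proof.
have [bp lp] := bounded_by_norm p; have [bq lq] := bounded_by_norm q.
apply: unitization_norm_le; split=> [b|].
  by rewrite uactD mulrDl (le_trans (rnormD _ _)) // lerD.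
by rewrite (le_trans (rnormD _ _)) // lerD.
Qed.

Let normM' p q : N (p * q) <= N p * N q.
Proof.
have [bp lp] := bounded_by_norm p; have [bq lq] := bounded_by_norm q.
apply: unitization_norm_le; split=> [b|].
  rewrite uactM (le_trans (bp _)) // -mulrA ler_wpM2l //.
  exact: bounded_by_ge0 (bounded_by_norm p).
by rewrite unitization_mulE /= rnormM ler_pM ?rnorm_ge0.
Qed.

Let normZ_le (l : R[i]) p : N (l *: p) <= rnorm l * N p.
Proof.
have [bp lp] := bounded_by_norm p.
apply: unitization_norm_le; split=> [b|].
  by rewrite uactZ rnormZ -mulrA ler_wpM2l ?rnorm_ge0.
by rewrite /= rnormM ler_wpM2l ?rnorm_ge0.
Qed.

Let normZ' (l : R[i]) p : N (l *: p) = rnorm l * N p.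
Proof.
apply/eqP; rewrite eq_le normZ_le /=.
have [->|l0] := eqVneq l 0.
  by rewrite rnorm0 mul0r (bounded_by_ge0 (bounded_by_norm _)).
have lp : 0 < rnorm l.
  by rewrite lt_def rnorm_ge0 andbT; apply: contraNneq l0 => /rnorm0_eq0 ->.
rewrite -ler_pdivlMl // -rnormV; apply: le_trans (normZ_le _ _).
by rewrite scalerA mulVf // scale1r.
Qed.

Let norm0' p : N p = 0 -> p = 0.
Proof.
move=> p0; have [_] := bounded_by_norm p; have := rnorm_fst_le p.
rewrite p0 mulr0; case: p p0 => a l _ /= a0 l0.
have -> : a = 0 by apply: rnorm0_eq0; apply/eqP; rewrite eq_le a0 rnorm_ge0.
by have -> : l = 0 by apply: rnorm0_eq0; apply/eqP; rewrite eq_le l0 rnorm_ge0.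
Qed.

Let norm_sqr_le p : N p ^+ 2 <= N (st p * p).
Proof.
have K0 := bounded_by_ge0 (bounded_by_norm (st p * p)).
have [bK lK] := bounded_by_norm (st p * p).
rewrite -(sqr_sqrtr K0) ler_pXn2r ?nnegrE ?sqrtr_ge0 //; last first.
  exact: bounded_by_ge0 (bounded_by_norm p).
apply: unitization_norm_le; split=> [b|].
  rewrite -(ler_pXn2r (n := 2)) ?nnegrE ?mulr_ge0 ?sqrtr_ge0 ?rnorm_ge0 //.
  rewrite exprMn sqr_sqrtr // -rnorm_star_cmul star_uact -uactM.
  rewrite (le_trans (rnorm_cmul _ _)) // rnorm_star expr2 mulrA mulrC.
  by rewrite ler_wpM2r ?rnorm_ge0.
rewrite -(ler_pXn2r (n := 2)) ?nnegrE ?sqrtr_ge0 ?rnorm_ge0 // sqr_sqrtr //.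
by move: lK; rewrite unitization_mulE /= rnormM rnorm_conj expr2.
Qed.

Let norm_star_mul' p : N (st p * p) = N p ^+ 2.
Proof.
have le q : N q <= N (st q).
  have := le_trans (norm_sqr_le q) (normM' _ _); rewrite expr2.
  have := bounded_by_ge0 (bounded_by_norm q).
  rewrite le_eqVlt => /predU1P[<- _|b0]; last by rewrite ler_pM2r.
  exact: bounded_by_ge0 (bounded_by_norm _).
apply/eqP; rewrite eq_le norm_sqr_le andbT (le_trans (normM' _ _)) // expr2.
rewrite ler_wpM2r ?(bounded_by_ge0 (bounded_by_norm _)) //.
by rewrite -{2}[p]starK' le.
Qed.

Let norm_complete (u : nat -> unitization) :
  (forall e : R, 0 < e ->
     exists n0, forall m n, (n0 <= m)%N -> (n0 <= n)%N -> N (u m - u n) < e) ->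
  exists l, forall e : R, 0 < e ->
     exists n0, forall n, (n0 <= n)%N -> N (u n - l) < e.
Proof.
move=> cau.
have [|a aP] := @rnorm_complete R A (fun n => (u n).1).
  move=> e e0; have [|n0 n0P] := cau (e / 2); first by rewrite divr_gt0.
  exists n0 => m n m0 m1; apply: le_lt_trans (rnorm_fst_le (u m - u n)) _.
  by rewrite mulrC -ltr_pdivlMr // n0P.
have [|l lP] := @complex_complete R (fun n => (u n).2).
  move=> e /cau[n0 n0P]; exists n0 => m n m0 m1.
  by apply: le_lt_trans (n0P _ _ m0 m1); exact: (bounded_by_norm (u m - u n)).2.
exists (a, l) => e e0; have e20 : 0 < e / 2 by rewrite divr_gt0.
have [n0 n0P] := aP _ e20; have [n1 n1P] := lP _ e20.
exists (maxn n0 n1) => n; rewrite geq_max => /andP[/n0P h0 /n1P h1].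
apply: le_lt_trans (unitization_norm_le (has_bound _)) _ => /=.
by rewrite [e]splitr ltrD.
Qed.

HB.instance Definition _ := Algebra_isUnitalCstar.Build R unitization
  starD' starZ' starM' starK' normD' normZ' normM' norm0' norm_star_mul'
  norm_complete.

End Unitization.

(** * Positivity in a C*-algebra *)

Section CstarPositivity.
Variables (R : realType) (A : cstarAlgType R).
Implicit Types a b c h : A.

Let inj (a : A) : unitization A := (a, 0).

Let injM a b : inj a * inj b = inj (cmul a b).
Proof. by rewrite unitization_mulE /= !scale0r !addr0 mulr0. Qed.

Let injD a b : inj (a + b) = inj a + inj b.
Proof. by congr (_, _); rewrite /= addr0. Qed.

Let injN a : inj (- a) = - inj a.
Proof. by congr (_, _); rewrite /= oppr0. Qed.

Let injZ (l : R[i]) a : inj (l *: a) = l *: inj a.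
Proof. by congr (_, _); exact/esym/mulr0. Qed.

Let inj_star a : ustar (inj a) = inj (star a).
Proof. by congr (_, _); rewrite /= conjC0. Qed.

Let cpositiveE a : cpositive a <-> upositive (inj a).
Proof.
have spec (l : R[i]) : cspectrum a l <-> ~ invertible (inj a - l%:A).
  have -> : l%:A = (0, l) :> unitization A.
    by congr (_, _); [exact: scaler0|exact: mulr1].
  have -> : inj a - (0, l) = (a, - l) by congr (_, _); rewrite /= ?subr0 ?sub0r.
  by [].
split=> -[sa pa]; split.
- by rewrite inj_star sa.
- by move=> l /spec /pa.
- by move: sa; rewrite inj_star => -[].
- by move=> l /spec /pa.
Qed.

Lemma cpositiveD a b : cpositive a -> cpositive b -> cpositive (a + b).
Proof. by rewrite !cpositiveE injD; exact: upositiveD. Qed.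

Lemma cpositiveZ (r : R) a : 0 <= r -> cpositive a -> cpositive (r%:C *: a).
Proof. by rewrite !cpositiveE injZ; exact: upositiveZ. Qed.

Lemma cpositive_star_mul a : cpositive (cmul (star a) a).
Proof. by rewrite cpositiveE -injM -inj_star; exact: upositive_star_mul. Qed.

(** A root [b + l 1] found in the unitization lies in [A], since [l ^ 2 = 0]. *)
Lemma csquare_csqrt a : cpositive a -> csquare (csqrt a) = a.
Proof.
move=> pa; apply: (@xgetPex _ 0 [set b : A | cpositive b /\ csquare b = a]%classic _).2.
have /upositive_sqrt[[b l] [pb bb _]] := (cpositiveE a).1 pa.
have l0 : l = 0.
  have : l * l = 0 by case: bb.
  by move=> /eqP; rewrite mulf_eq0 orbb => /eqP.
rewrite l0 in pb bb; exists b; split; first exact/cpositiveE.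
by move: bb; rewrite -/(inj b) injM => -[].
Qed.

Lemma csquare_cabs a : csquare (cabs a) = cmul (star a) a.
Proof. exact/csquare_csqrt/cpositive_star_mul. Qed.

(** [|h| - h] is positive in the unitization, and conjugation by [c] brings it
    back to [A]. *)
Lemma cle_conj_norm h c : cpositive h ->
  cle (cmul (star c) (cmul h c)) ((rnorm h)%:C *: cmul (star c) c).
Proof.
rewrite /cle !cpositiveE => ph.
have ph' : upositive ((rnorm h)%:C%:A - inj h).
  apply: (@upositive_of_norm _ _ _ (rnorm h)).
    by rewrite ustarB ustar_scalar conjC_real ph.1.
  by rewrite opprB addrC subrK norm_element_le.
have := upositive_conj (inj c) ph'.
by rewrite mulrBr mulrBl mulr_algr -scalerAl inj_star -mulrA !injM -injZ -injN -injD.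
Qed.

End CstarPositivity.

(** * Hilbert modules *)

Section HilbertModuleTheory.
Variables (R : realType) (A : cstarAlgType R) (X : hilbertModType A).
Implicit Types x y z : X.

Lemma hinnerDr x y z : hinner x (y + z) = hinner x y + hinner x z.
Proof. by have := hinner_linearr 1 x y z; rewrite !scale1r. Qed.

Lemma hinner0r x : hinner x 0 = 0.
Proof. by apply: (addIr (hinner x 0)); rewrite -hinnerDr !add0r. Qed.

Lemma hinnerZr (l : R[i]) x y : hinner x (l *: y) = l *: hinner x y.
Proof. by have := hinner_linearr l x y 0; rewrite !addr0 hinner0r addr0. Qed.

Lemma hinnerBr x y z : hinner x (y - z) = hinner x y - hinner x z.
Proof. by rewrite hinnerDr -scaleN1r hinnerZr scaleN1r. Qed.

Lemma hinner_sumr (I : finType) x (z : I -> X) :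
  hinner x (\sum_i z i) = \sum_i hinner x (z i).
Proof. exact: (big_morph _ (hinnerDr x) (hinner0r x)). Qed.

Lemma hinner0l x : hinner 0 x = 0.
Proof. by rewrite -star_hinner hinner0r star0. Qed.

Lemma hinnerDl x y z : hinner (x + y) z = hinner x z + hinner y z.
Proof. by rewrite -!(star_hinner z) hinnerDr starD. Qed.

Lemma hinner_suml (I : finType) x (z : I -> X) :
  hinner (\sum_i z i) x = \sum_i hinner (z i) x.
Proof.
exact: (big_morph (fun z => hinner z x) (fun y z => hinnerDl y z x) (hinner0l x)).
Qed.

Lemma hinnerZl (r : R) x y : hinner (r%:C *: x) y = r%:C *: hinner x y.
Proof. by rewrite -!(star_hinner y) hinnerZr starZ conjC_real. Qed.

Lemma hinnerBl x y z : hinner (x - y) z = hinner x z - hinner y z.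
Proof.
rewrite hinnerDl -[- y]scale1r scalerN -scaleNr -[1]/(1%:C) -rmorphN hinnerZl.
by rewrite rmorphN scaleN1r.
Qed.

Lemma hinner_actl x y (a : A) : hinner (hact x a) y = cmul (star a) (hinner x y).
Proof. by rewrite -(star_hinner y) hinner_actr starM star_hinner. Qed.

Lemma csquare_habs x : csquare (habs x) = hinner x x.
Proof. exact/csquare_csqrt/hinner_ge0. Qed.

Lemma rnorm_hinner_self x : rnorm (hinner x x) = rnorm x ^+ 2.
Proof.
apply: complexI; rewrite rmorphXn /= -!rnormE (hnormE x) sqrtCK //.
Qed.

(** Expand the positive element [<w, w>] for [w = t x - z <z, x>], where
    [t = |<z, z>|], and replace its last term [c^* <z, z> c], with [c = <z, x>], by
    the larger [t c^* c]; then divide by [t]. *)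
Theorem cauchy_schwarz_module x z :
  cle (cmul (hinner x z) (hinner z x)) ((rnorm (hinner z z))%:C *: hinner x x).
Proof.
set h := hinner z z; set c := hinner z x; set t := rnorm h.
have t0 : 0 <= t by exact: rnorm_ge0.
have cE : hinner x z = star c by rewrite star_hinner.
have [tz|tz] := eqVneq t 0.
  have z0 : z = 0 by apply/hinner_eq0; exact: rnorm0_eq0.
  rewrite /cle cE /c z0 hinner0l cmul0r tz scale0r subr0.
  by have := hinner_ge0 (0 : X); rewrite hinner0l.
have := cpositiveD (hinner_ge0 (t%:C *: x - hact z c))
                   (cle_conj_norm c (hinner_ge0 z)).
set p := cmul (star c) c; set q := cmul (star c) (cmul _ c).
have -> : hinner (t%:C *: x - hact z c) (t%:C *: x - hact z c) =
    t%:C *: (t%:C *: hinner x x) - t%:C *: p - (t%:C *: p - q).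
  rewrite hinnerBr !hinnerBl !hinnerZl !hinnerZr !hinner_actl !hinner_actr.
  by rewrite cE.
rewrite subrK -scalerBr => /(cpositiveZ (r := t^-1)).
rewrite invr_ge0 scalerA -rmorphM mulVf // scale1r /cle cE.
exact.
Qed.

End HilbertModuleTheory.

(** * Scalar estimates and the inequality *)

Section RealEstimates.
Variable R : realType.

(** Lagrange's identity. *)
Lemma cauchy_schwarz_sum (I : finType) (P : pred I) (u v : I -> R) :
  (\sum_(i | P i) u i * v i) ^+ 2 <=
  (\sum_(i | P i) u i ^+ 2) * (\sum_(i | P i) v i ^+ 2).
Proof.
have : 0 <= \sum_(i | P i) \sum_(j | P j) (u i * v j - u j * v i) ^+ 2.
  by apply: sumr_ge0 => i _; apply: sumr_ge0 => j _; exact: sqr_ge0.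
have e : \sum_(i | P i) \sum_(j | P j) (u i * v j - u j * v i) ^+ 2 =
  \sum_(i | P i) \sum_(j | P j) u i ^+ 2 * v j ^+ 2
  + \sum_(i | P i) \sum_(j | P j) u j ^+ 2 * v i ^+ 2
  - 2 * \sum_(i | P i) \sum_(j | P j) (u i * v i) * (u j * v j).
  rewrite mulr_sumr -big_split -sumrB; apply: eq_bigr => i _ /=.
  rewrite mulr_sumr -big_split -sumrB; apply: eq_bigr => j _ /=.
  ring.
rewrite {}e [X in _ + X - _]exchange_big /=.
rewrite -!big_distrlr /= -expr2; lra.
Qed.

(** The diagonal and off-diagonal parts are bounded apart; for the latter the
    Cauchy-Schwarz inequality is applied over the pairs [i != j], and the sum of
    [(al i * al j) ^ 2] extended to all pairs, where it is the square of the
    sum of the [al i ^ 2]. *)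
Lemma quadratic_form_le n (al : 'I_n -> R) (g : 'I_n -> 'I_n -> R) (M : R) :
  (forall i, g i i <= M) ->
  \sum_i \sum_j al i * g i j * al j <=
  (\sum_i al i ^+ 2) *
    (M + Num.sqrt (\sum_(p : 'I_n * 'I_n | p.1 != p.2) g p.1 p.2 ^+ 2)).
Proof.
move=> gM.
have -> : \sum_i \sum_j al i * g i j * al j = \sum_i al i ^+ 2 * g i i +
    \sum_(p : 'I_n * 'I_n | p.1 != p.2) (al p.1 * al p.2) * g p.1 p.2.
  rewrite -(pair_big_dep xpredT (fun i j => i != j)
    (fun i j => (al i * al j) * g i j)) -big_split; apply: eq_bigr => i _ /=.
  rewrite (bigD1 i) //=; congr (_ + _); first by ring.
  by apply: eq_big => [j|j _]; [rewrite eq_sym|ring].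
rewrite mulrDr lerD //.
  by rewrite mulr_suml ler_sum // => i _; rewrite ler_wpM2l ?sqr_ge0.
set S := \sum_i al i ^+ 2; set G := \sum_(p | _) g _ _ ^+ 2.
have S0 : 0 <= S by apply: sumr_ge0 => i _; exact: sqr_ge0.
have G0 : 0 <= G by apply: sumr_ge0 => i _; exact: sqr_ge0.
apply: le_trans (ler_norm _) _.
rewrite -(ler_pXn2r (n := 2)) ?nnegrE ?mulr_ge0 ?sqrtr_ge0 //.
rewrite exprMn sqr_sqrtr // real_normK ?num_real //.
apply: le_trans (cauchy_schwarz_sum _ _ _) _; rewrite ler_wpM2r // expr2 /S.
rewrite big_distrlr /= pair_big /= [leRHS](bigID (fun p => p.1 != p.2)) /=.
under eq_bigr do rewrite exprMn.
by rewrite lerDl sumr_ge0 // => p _; rewrite mulr_ge0 ?sqr_ge0.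
Qed.

Lemma rnorm_sum_le (V : normedZmodType R[i]) (I : finType) (v : I -> V) :
  rnorm (\sum_i v i) <= \sum_i rnorm (v i).
Proof.
elim/big_ind2: _ => [|a b c d ab cd|//]; first by rewrite rnorm0.
by rewrite (le_trans (rnormD _ _)) // lerD.
Qed.

Lemma sqrtC_real (r : R) : 0 <= r -> sqrtC r%:C = (Num.sqrt r)%:C.
Proof.
by move=> r0; rewrite -{1}(sqr_sqrtr r0) rmorphXn /= sqrCK // lecR sqrtr_ge0.
Qed.

Lemma bigmax_real n (F : 'I_n -> R) :
  \big[Num.max/0]_(i < n) (F i)%:C = (\big[Num.max/0]_(i < n) F i)%:C.
Proof.
apply/esym/(big_morph (real_complex R)) => // a b.
by rewrite /Order.max ltcR; case: ifP.
Qed.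

End RealEstimates.

Theorem corollary3p9 (R : realType) (A : cstarAlgType R)
    (X : hilbertModType A) (n : nat) (x : X) (y : 'I_n -> X) :
  cle (csquare (\sum_(i < n) csquare (cabs (hinner (y i) x))))
      (((\sum_(i < n) `|hinner (y i) x| ^+ 2) *
        (\big[Num.max/0]_(i < n) (`|y i| ^+ 2) +
         sqrtC (\sum_(p : 'I_n * 'I_n | p.1 != p.2)
                  `|hinner (y p.1) (y p.2)| ^+ 2)))
       *: csquare (habs x)).
Proof.
pose a i := hinner (y i) x; pose z := \sum_i hact (y i) (a i).
have sumE : \sum_(i < n) csquare (cabs (a i)) = hinner x z.
  rewrite hinner_sumr; apply: eq_bigr => i _.
  by rewrite csquare_cabs hinner_actr star_hinner.
have zx : hinner z x = hinner x z.
  rewrite [RHS]hinner_sumr hinner_suml; apply: eq_bigr => i _.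
  by rewrite hinner_actr hinner_actl star_hinner.
rewrite -/(a _) sumE csquare_habs /csquare -{2}zx.
set k := (_ * _)%R.
pose M := \big[Num.max/0]_(i < n) (rnorm (y i) ^+ 2).
pose g i j := rnorm (hinner (y i) (y j)).
pose r := (\sum_i rnorm (a i) ^+ 2) *
  (M + Num.sqrt (\sum_(p : 'I_n * 'I_n | p.1 != p.2) g p.1 p.2 ^+ 2)).
have -> : k = r%:C.
  rewrite /k /r rmorphM rmorphD /= -sqrtC_real; last first.
    by apply: sumr_ge0 => i _; exact: sqr_ge0.
  rewrite !rmorph_sum /= -bigmax_real; congr (_ * (_ + sqrtC _)).
  - by apply: eq_bigr => i _; rewrite rmorphXn /= -rnormE.
  - by apply: eq_bigr => i _; rewrite rmorphXn /= -rnormE.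
  - by apply: eq_bigr => i _; rewrite rmorphXn /= -rnormE.
have zr : rnorm (hinner z z) <= r.
  apply: le_trans (quadratic_form_le (M := M) _ _); last first.
    by move=> i; rewrite /g rnorm_hinner_self; exact: le_bigmax.
  rewrite hinner_suml; apply: (le_trans (rnorm_sum_le _)); apply: ler_sum => i _.
  rewrite hinner_sumr; apply: (le_trans (rnorm_sum_le _)); apply: ler_sum => j _.
  rewrite hinner_actr hinner_actl (le_trans (rnorm_cmul _ _)) //.
  rewrite ler_wpM2r ?rnorm_ge0 // (le_trans (rnorm_cmul _ _)) //.
  by rewrite rnorm_star.
have -> : r%:C *: hinner x x = (r - rnorm (hinner z z))%:C *: hinner x x
    + (rnorm (hinner z z))%:C *: hinner x x.
  by rewrite -scalerDl -rmorphD subrK.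
rewrite /cle -addrA; apply: cpositiveD; last exact: cauchy_schwarz_module.
by apply: cpositiveZ; [rewrite subr_ge0|exact: hinner_ge0].
Qed.
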